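(* The following two assertions are equivalent. (a) For every $n\ge 2$ and every symplectically self-polar convex body $X\subset\mathbb R^{2n}$ with $\operatorname{vol} X\ge 2^n/n!$, any linear symplectic reduction $Y$ of $X$ of dimension $2n-2$ has volume $\operatorname{vol} Y\ge 2^{n-1}/(n-1)!$. (b) Mahler's conjecture for centrally symmetric bodies: for every $n\ge 1$ and every centrally symmetric convex body $K\subset\mathbb R^n$ one has $\operatorname{vol} K\cdot\operatorname{vol} K^\circ\ge\frac{4^n}{n!}$.
   Context: A convex body is a compact convex set with nonempty interior; it is centrally symmetric if $K=-K$. For a convex body $K\subset\mathbb R^n$ with the origin in its interior, $K^\circ=\{y\in\mathbb R^n : x\cdot y\le 1 \ \forall x\in K\}$. Let $\omega$ be the standard symplectic form on $\mathbb R^{2n}$. For a convex body $X\subset\mathbb R^{2n}$ with the origin in its interior, its symplectic polar is $X^\omega=\{y\in\mathbb R^{2n} : \omega(x,y)\le 1\ \forall x\in X\}$; $X$ is symplectically self-polar if it contains the origin in its interior and $X=X^\omega$. A linear symplectic reduction of a convex body $X\subset\mathbb R^{2n}$ is obtained as follows: take an isotropic linear subspace $V\subset\mathbb R^{2n}$ (i.e. $\omega|_V=0$), let $V^{\perp_\omega}=\{y:\omega(x,y)=0\ \forall x\in V\}\supseteq V$, and let $Y$ be the image of $X\cap V^{\perp_\omega}$ under the quotient map $V^{\perp_\omega}\to V^{\perp_\omega}/V$, considered as a convex body in the symplectic vector space $V^{\perp_\omega}/V$ with the form induced by $\omega$. The reduction has dimension $2n-2$ when $\dim V=1$; then $V^{\perp_\omega}/V$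 is identified with $\mathbb R^{2n-2}$ with its standard symplectic form by a linear symplectomorphism, and $\operatorname{vol} Y$ is the corresponding Lebesgue measure (independent of the choice of the symplectomorphism). *)

(* Defs.v *)
From HB Require Import structures.
From mathcomp Require Import all_boot all_order all_algebra.
From mathcomp Require Import all_classical all_reals all_analysis.
Set Implicit Arguments.
Unset Strict Implicit.
Unset Printing Implicit Defensive.
Import Order.TTheory GRing.Theory Num.Theory.
Import numFieldNormedType.Exports.
Local Open Scope classical_set_scope.
Local Open Scope ring_scope.

(* Lebesgue measure on R^n as the n-fold product of [lebesgue_measure]: the
   recursion is the formula defining the library's product measure [m1 \x m2],
   with the first coordinate [t] split off (R^0 is a single point, of volume 1).
   As a set function it is meaningful on Borel sets only. *)
Fixpoint vol {R : realType} (n : nat) : set 'rV[R]_n -> \bar R :=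
  match n with
  | 0 => fun A => (\1_A 0)%:E
  | k.+1 => fun A =>
      (\int[@lebesgue_measure R]_t
         vol [set v : 'rV[R]_k | A (row_mx (t%:M : 'rV[R]_1) v)])%E
  end.

Definition dotp {R : realType} {n : nat} (x y : 'rV[R]_n) : R :=
  \sum_(i < n) x 0 i * y 0 i.

Definition convex_body {R : realType} {n : nat} (K : set 'rV[R]_n) : Prop :=
  [/\ compact K, convex_set K & K° !=set0].

Definition centrally_symmetric {R : realType} {n : nat} (K : set 'rV[R]_n) :
    Prop :=
  K = [set - x | x in K].

Definition polar {R : realType} {n : nat} (K : set 'rV[R]_n) : set 'rV[R]_n :=
  [set y | forall x, K x -> dotp x y <= 1].

(* R^(2n) is ['rV[R]_(n + n)]: the left block of coordinates is q, the right
   block is p, and omega = \sum_i dq_i /\ dp_i. *)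
Definition omega {R : realType} {n : nat} (x y : 'rV[R]_(n + n)) : R :=
  dotp (lsubmx x) (rsubmx y) - dotp (rsubmx x) (lsubmx y).

Definition symplectic_polar {R : realType} {n : nat}
    (X : set 'rV[R]_(n + n)) : set 'rV[R]_(n + n) :=
  [set y | forall x, X x -> omega x y <= 1].

Definition symplectically_self_polar {R : realType} {n : nat}
    (X : set 'rV[R]_(n + n)) : Prop :=
  X° 0 /\ X = symplectic_polar X.

Definition isotropic {R : realType} {n : nat}
    (V : {vspace 'rV[R]_(n + n)}) : Prop :=
  forall x y, x \in V -> y \in V -> omega x y = 0.

Definition symplectic_orth {R : realType} {n : nat}
    (V : {vspace 'rV[R]_(n + n)}) : set 'rV[R]_(n + n) :=
  [set y | forall x, x \in V -> omega x y = 0].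

(* On the orthogonal W of V, [f] is the composition of the quotient map
   W -> W / V with a linear symplectomorphism W / V -> R^(2m). Only the values
   of [f] on W matter; every linear map on W extends to the whole space. *)
Definition symplectic_quotient_map {R : realType} {n m : nat}
    (V : {vspace 'rV[R]_(n + n)})
    (f : {linear 'rV[R]_(n + n) -> 'rV[R]_(m + m)}) : Prop :=
  [/\ forall x, symplectic_orth V x -> (f x = 0 <-> x \in V),
      f @` symplectic_orth V = setT
    & forall x y, symplectic_orth V x -> symplectic_orth V y ->
        omega (f x) (f y) = omega x y].

(* Y ranges over all models in R^(2m) of the reductions of X of dimension 2m.
   As W / V has dimension 2n - 2 \dim V, the existence of [f] forces
   \dim V = n - m; in particular \dim V = 1 when m = n - 1. *)
Definition linear_symplectic_reduction {R : realType} {n m : nat}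
    (X : set 'rV[R]_(n + n)) (Y : set 'rV[R]_(m + m)) : Prop :=
  exists V : {vspace 'rV[R]_(n + n)},
  exists f : {linear 'rV[R]_(n + n) -> 'rV[R]_(m + m)},
    [/\ isotropic V, symplectic_quotient_map V f
      & Y = f @` (X `&` symplectic_orth V)].

(* Main.v *)
(** A convex body symmetric about 0 is the unit ball of a gauge, and polarity is
    duality of gauges; the volume of a unit ball is read off from the integral of
    [exp (- g)] or [exp (- g ^ 2)], which is multiplicative on direct sums.

    If Mahler's conjecture holds: a reduction [Y] of a self-polar body is
    self-polar by separation, and [Y]'s polar is [Y] up to a swap of coordinates,
    so [(vol Y)^2 >= 4^(2m) / (2m)! >= (2^m / m!)^2].

    If it fails for some [K]: passing from [K] to [K x K] squares the ratio
    [n! vol K vol K° / 4^n < 1], so after enough doublings the self-polar l2-sum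
    of [K] and [K°] in R^(2M) has volume below [2^M / M!]. The l2-sum of a
    self-polar body with a disc reduces to that body and multiplies [M! vol] by
    [pi]; if reductions preserve the lower bound [2^M / M!], all iterated sums
    stay below it, so [pi^k < C 2^k] for all [k], a contradiction. *)
Require Import Defs.
From HB Require Import structures.
From mathcomp Require Import all_boot all_order all_algebra.
From mathcomp Require Import all_classical all_reals all_analysis.
From mathcomp Require Import measurable_realfun.
From mathcomp Require Import ring lra zify.
Set Implicit Arguments.
Unset Strict Implicit.
Unset Printing Implicit Defensive.
Import Order.TTheory GRing.Theory Num.Theory.
Import numFieldNormedType.Exports.
Local Open Scope classical_set_scope.
Local Open Scope ring_scope.

(** * Iterated integrals *)

(** The normalisation [M! vol] turns the bound [2^M / M!] into [2^M] and makes l2-sums of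
    even-dimensional bodies multiplicative. The unit disc is self-polar with normalised volume [pi],
    strictly above its bound 2; this excess is what finally contradicts a deficient body. Passing
    from [K] and its polar to their l2-sum loses something: the two bounds differ by a central
    binomial coefficient, estimated here up to one plus the dimension of [K]. A ratio merely below 1
    could be lost there, whereas under doubling its powers decay exponentially in the dimension. The
    integral of [exp (- g ^ 2)] yields a plain factorial in even dimension, which is why a last
    doubling is kept apart just before the l2-sum. Gauges come with attained suprema, so that each
    duality is proved by an inequality and an explicit witness. Since volumes are iterated
    integrals, Tonelli is set up for functions of row vectors, and every change of variables is
    composed of scalings, reflections and exchanges of blocks of coordinates. *)

Fixpoint iint {R : realType} (n : nat) : ('rV[R]_n -> \bar R) -> \bar R :=
  match n with
  | 0 => fun f => f 0
  | k.+1 => fun f =>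
      (\int[@lebesgue_measure R]_t
         iint (fun v : 'rV[R]_k => f (row_mx (t%:M : 'rV[R]_1) v)))%E
  end.

Lemma vol_iint (R : realType) n (A : set 'rV[R]_n) :
  vol A = iint (fun x => (\1_A x)%:E).
Proof.
elim: n A => [//|n IH] A /=; apply: eq_integral => t _; rewrite IH.
congr iint.
Qed.

Lemma eq_iint (R : realType) n (f g : 'rV[R]_n -> \bar R) :
  f =1 g -> iint f = iint g.
Proof. by move=> /funext ->. Qed.

Lemma iint_ge0 (R : realType) n (f : 'rV[R]_n -> \bar R) :
  (forall x, 0 <= f x)%E -> (0 <= iint f)%E.
Proof.
elim: n f => [|n IH] f f0 /=; first exact: f0.
by apply: integral_ge0 => t _; exact: IH.
Qed.

(** In general [row_mx] is associative only up to a cast of the dimension. With a first block of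
    width 1 the two widths are convertible, and this is the form that the recursion of [iint]
    produces. *)
Lemma row_mx1A (R : realType) m n (t : R) (x : 'rV[R]_m) (y : 'rV[R]_n) :
  row_mx (row_mx (t%:M : 'rV_1) x) y = row_mx (t%:M : 'rV_1) (row_mx x y).
Proof.
apply/rowP => i; rewrite !mxE.
case: (@splitP 1 (m + n) i) => j ij; rewrite !mxE.
  case: (@splitP m.+1 n i) => k ik; last by move: ij; rewrite ik ord1.
  rewrite mxE; case: (@splitP 1 m k) => l kl; first by rewrite !mxE !ord1.
  by move: ij; rewrite ik kl ord1.
case: (@splitP m.+1 n i) => k ik; case: (@splitP m n j) => l jl.
- rewrite mxE; case: (@splitP 1 m k) => p kp.
    by move: ij; rewrite ik kp ord1.
  by congr (x _ _); apply/val_inj/eqP; rewrite /= -(eqn_add2l 1) -jl -ij ik kp.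
- suff : (m.+1 <= k)%N by rewrite leqNgt ltn_ord.
  by rewrite -ik ij jl addnA leq_addr.
- suff : (m <= l)%N by rewrite leqNgt ltn_ord.
  by rewrite -jl -(leq_add2l 1) -ij ik leq_addr.
- by congr (y _ _); apply/val_inj/eqP; rewrite /= -(eqn_add2l m.+1) -ik ij jl.
Qed.

(** Both sides integrate the coordinates in the same order: this is a regrouping, not yet an
    exchange of integrals. *)
Lemma iint_add (R : realType) m n (f : 'rV[R]_(m + n) -> \bar R) :
  iint f = iint (fun x => iint (fun y : 'rV_n => f (row_mx x y))).
Proof.
elim: m f => [|m IH] f /=.
  apply: eq_iint => y; congr f; apply/rowP => i; rewrite mxE.
  by case: (@splitP 0 n i) => [[]//|j ij]; congr (y _ _); apply/val_inj.
apply: eq_integral => t _; rewrite IH; apply: eq_iint => x; apply: eq_iint => y.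
by rewrite row_mx1A.
Qed.

(* Measurability on ['rV_n] is tested on parametrized points with measurable
   coordinates, which avoids putting a sigma-algebra on ['rV_n]. *)
Definition coord_measurable d (S : measurableType d) (R : realType) n
    (c : S -> 'rV[R]_n) :=
  forall i, measurable_fun [set: S] (fun s => c s 0 i).

Definition Borel_fun (R : realType) n (f : 'rV[R]_n -> \bar R) :=
  forall d (S : measurableType d) (c : S -> 'rV[R]_n),
    coord_measurable c -> measurable_fun [set: S] (fun s => f (c s)).

(** Joint measurability in parameter and point. Both arguments may be reparametrized, so that an
    integration variable can be moved into the parameter space during an induction. *)
Definition Borel_kernel d (S : measurableType d) (R : realType) n
    (F : S -> 'rV[R]_n -> \bar R) :=
  forall d' (S' : measurableType d') (a : S' -> S) (c : S' -> 'rV[R]_n),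
    measurable_fun [set: S'] a -> coord_measurable c ->
    measurable_fun [set: S'] (fun s => F (a s) (c s)).

Lemma coord_measurable_row_mx d (S : measurableType d) (R : realType) m n
    (a : S -> 'rV[R]_m) (b : S -> 'rV[R]_n) :
  coord_measurable a -> coord_measurable b ->
  coord_measurable (fun s => row_mx (a s) (b s)).
Proof.
move=> ma mb i; under eq_fun do rewrite mxE.
by case: (fintype.split i) => j; [exact: ma|exact: mb].
Qed.

Lemma coord_measurable_scalar d (S : measurableType d) (R : realType)
    (a : S -> R) :
  measurable_fun [set: S] a -> coord_measurable (fun s => (a s)%:M : 'rV[R]_1).
Proof. by move=> ma i; under eq_fun do rewrite ord1 mxE eqxx mulr1n. Qed.

Lemma measurable_iint d (S : measurableType d) (R : realType) n
    (F : S -> 'rV[R]_n -> \bar R) :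
  (forall s v, 0 <= F s v)%E -> Borel_kernel F ->
  measurable_fun [set: S] (fun s => iint (F s)).
Proof.
elim: n d S F => [|n IH] d S F F0 mF /=.
  by apply: mF => // i; exact: measurable_cst.
(* The first coordinate joins the parameter: the induction hypothesis over [S * R] makes [H] jointly
   measurable, and Tonelli integrates that coordinate out. *)
pose H (p : S * R) := iint (fun v : 'rV_n => F p.1 (row_mx p.2%:M v)).
apply: (measurable_fun_fubini_tonelli_F (m2 := @lebesgue_measure R) H).
  apply: IH => // d' S' a c ma mc.
  apply: mF; first exact: measurableT_comp.
    apply: (@coord_measurable_row_mx _ _ _ 1) => //;
      apply: coord_measurable_scalar.
  exact: measurableT_comp.
by move=> p; exact: iint_ge0.
Qed.

Lemma integral_iintC d (S : measurableType d) (R : realType) n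
    (mu : {sigma_finite_measure set S -> \bar R})
    (F : S -> 'rV[R]_n -> \bar R) :
  (forall s v, 0 <= F s v)%E -> Borel_kernel F ->
  (\int[mu]_s iint (F s) = iint (fun v => \int[mu]_s F s v))%E.
Proof.
elim: n F => [//|n IH] F F0 mF /=.
pose H (p : S * R) := iint (fun v : 'rV_n => F p.1 (row_mx p.2%:M v)).
rewrite (fubini_tonelli (m1 := mu) (m2 := @lebesgue_measure R) H).
- apply: eq_integral => t _; apply: IH => // d' S' a c ma mc.
  apply: mF => //; apply: (@coord_measurable_row_mx _ _ _ 1) => //.
  by apply: coord_measurable_scalar; exact: measurable_cst.
- apply: measurable_iint => // d' S' a c ma mc.
  apply: mF; first exact: measurableT_comp.
  apply: (@coord_measurable_row_mx _ _ _ 1) => //;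
    apply: coord_measurable_scalar.
  exact: measurableT_comp.
- by move=> p; exact: iint_ge0.
Qed.

Lemma iintC (R : realType) m n (f : 'rV[R]_(m + n) -> \bar R) :
  (forall z, 0 <= f z)%E -> Borel_fun f ->
  iint (fun x => iint (fun y : 'rV_n => f (row_mx x y))) =
  iint (fun y => iint (fun x : 'rV_m => f (row_mx x y))).
Proof.
elim: m f => [//|m IH] f f0 mf /=.
transitivity (\int[@lebesgue_measure R]_t iint (fun y : 'rV_n =>
    iint (fun x : 'rV_m => f (row_mx (row_mx t%:M x) y))))%E.
  apply: eq_integral => t _.
  under eq_iint do under eq_iint do rewrite row_mx1A.
  rewrite (IH (fun z => f (row_mx t%:M z)))//.
    by apply: eq_iint => y; apply: eq_iint => x; rewrite row_mx1A.
  move=> d S c mc; apply: (mf _ _ (fun s => row_mx (t%:M : 'rV_1) (c s))).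
  apply: (@coord_measurable_row_mx _ _ _ 1) => //.
rewrite integral_iintC//; first by move=> *; exact: iint_ge0.
move=> d S a c ma mc; apply: measurable_iint => // d' S' a' c' ma' mc'.
apply: mf; apply: coord_measurable_row_mx.
  apply: (@coord_measurable_row_mx _ _ _ 1) => //.
  by apply: coord_measurable_scalar; exact: measurableT_comp.
by move=> i; exact: (measurableT_comp (mc i)).
Qed.

(** * Scalings, reflections and monotonicity *)

Lemma integral_comp_scale (R : realType) (a : R) (f : R -> \bar R) :
  0 < a -> measurable_fun setT f -> (forall t, 0 <= f t)%E ->
  (\int[@lebesgue_measure R]_t f (a * t)%R =
   (a^-1)%:E * \int[@lebesgue_measure R]_t f t)%E.
Proof.
move=> a0 mf f0.
pose phi : measurableTypeR R -> measurableTypeR R := fun t => a * t.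
have mphi : measurable_fun setT phi by exact: measurable_funM.
have ainv : 0 <= a^-1 by rewrite invr_ge0 ltW.
have a_ge0 := ltW a0.
(* [nu] is [a] times the image of Lebesgue measure under [t -> a t]. It agrees with Lebesgue measure
   on half-open intervals, hence everywhere by uniqueness, and the change of variables becomes
   integration against a pushforward. *)
pose nu : {measure set (measurableTypeR R) -> \bar R} :=
  mscale (NngNum a_ge0)
    (measure_function_pushforward__canonical__measure_function_Measure
      (@lebesgue_measure R) mphi).
have E A : measurable A -> (@lebesgue_measure R) A = nu A.
  move=> mA; apply: lebesgue_measure_unique => //= _ [[x y]] _ <-.
  transitivity (a%:E * @lebesgue_measure R (`]x / a, y / a]%classic)%R)%E;
    last first.
    congr (_ * lebesgue_measure _)%E.
    apply/seteqP; split => t /=; rewrite !in_itv/= /phi;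
      by rewrite ltr_pdivrMr// ler_pdivlMr// mulrC.
  rewrite !lebesgue_measure_itv/= !lte_fin ltr_pM2r ?invr_gt0//.
  case: ifPn => _; last by rewrite mule0.
  by rewrite -!EFinB -EFinM; congr EFin; field; rewrite gt_eqF.
have -> : (\int[@lebesgue_measure R]_t f t = \int[nu]_t f t)%E.
  by apply: eq_measure_integral => A mA _; exact: E.
rewrite ge0_integral_mscale//= muleA -EFinM mulVf ?gt_eqF// mul1e.
by rewrite ge0_integral_pushforward.
Qed.

Lemma integral_compN (R : realType) (f : R -> \bar R) :
  measurable_fun setT f -> (forall t, 0 <= f t)%E ->
  (\int[@lebesgue_measure R]_t f (- t)%R = \int[@lebesgue_measure R]_t f t)%E.
Proof.
move=> mf f0.
transitivity (\int[pushforward (@lebesgue_measure R)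
    (-%R : _ -> measurableTypeR R)]_t f t)%E.
  by rewrite ge0_integral_pushforward.
by apply: eq_measure_integral => A mA _; exact: lebesgue_measureN.
Qed.

Lemma ge0_iintZl (R : realType) n (k : \bar R) (f : 'rV[R]_n -> \bar R) :
  (0 <= k)%E -> (forall x, 0 <= f x)%E -> Borel_fun f ->
  (iint (fun x => k * f x) = k * iint f)%E.
Proof.
elim: n f => [//|n IH] f k0 f0 mf /=.
rewrite -ge0_integralZl//.
- apply: eq_integral => t _; apply: IH => // d S c mc.
  apply: (mf _ _ (fun s => row_mx (t%:M : 'rV_1) (c s))).
  exact: (@coord_measurable_row_mx _ _ _ 1).
- apply: measurable_iint => // d S a c ma mc; apply: mf.
  apply: (@coord_measurable_row_mx _ _ _ 1) => //.
  exact: coord_measurable_scalar.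
- by move=> t _; exact: iint_ge0.
Qed.

Lemma Borel_fun_row_mxl (R : realType) m n (f : 'rV[R]_(m + n) -> \bar R) x :
  Borel_fun f -> Borel_fun (fun y => f (row_mx x y)).
Proof.
move=> mf d S c mc; apply: (mf _ _ (fun s => row_mx x (c s))).
by apply: coord_measurable_row_mx => // i; exact: measurable_cst.
Qed.

Lemma measurable_iint_row_mx (R : realType) n (f : 'rV[R]_n.+1 -> \bar R) :
  (forall x, 0 <= f x)%E -> Borel_fun f ->
  measurable_fun setT
    (fun t : R => iint (fun v : 'rV_n => f (row_mx (t%:M : 'rV_1) v))).
Proof.
move=> f0 mf; apply: measurable_iint => // d S a c ma mc; apply: mf.
apply: (@coord_measurable_row_mx _ _ _ 1) => //.
exact: coord_measurable_scalar.
Qed.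

Lemma iint_comp_scale (R : realType) n (a : R) (f : 'rV[R]_n -> \bar R) :
  0 < a -> (forall x, 0 <= f x)%E -> Borel_fun f ->
  (iint (fun x => f (a *: x)%R) = (a ^- n)%:E * iint f)%E.
Proof.
move=> a0; elim: n f => [|n IH] f f0 mf /=.
  by rewrite scaler0 invr1 mul1e.
transitivity (\int[@lebesgue_measure R]_t ((a ^- n)%:E *
    iint (fun v : 'rV_n => f (row_mx ((a * t)%:M : 'rV_1) v))))%E.
  apply: eq_integral => t _.
  rewrite -(IH (fun v => f (row_mx ((a * t)%:M : 'rV_1) v)))//.
    by apply: eq_iint => v; rewrite -scale_scalar_mx -scale_row_mx.
  exact: (@Borel_fun_row_mxl _ 1).
have mF := measurable_iint_row_mx f0 mf.
rewrite (@integral_comp_scale R a (fun t => ((a ^- n)%:E *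
    iint (fun v : 'rV_n => f (row_mx (t%:M : 'rV_1) v)))%E))//; first last.
- move=> t; apply: mule_ge0; last exact: iint_ge0.
  by rewrite lee_fin invr_ge0 exprn_ge0// ltW.
- exact: emeasurable_funM.
rewrite ge0_integralZl//; first last.
- by rewrite lee_fin invr_ge0 exprn_ge0 ?ltW.
- by move=> t _; exact: iint_ge0.
by rewrite muleA -EFinM exprS invfM.
Qed.

Lemma iint_compN (R : realType) n (f : 'rV[R]_n -> \bar R) :
  (forall x, 0 <= f x)%E -> Borel_fun f ->
  iint (fun x => f (- x)) = iint f.
Proof.
elim: n f => [|n IH] f f0 mf /=; first by rewrite oppr0.
rewrite -(@integral_compN R (fun t => iint (fun v => f (row_mx (t%:M : 'rV_1)
  v)))).
- apply: eq_integral => t _.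
  rewrite -(IH (fun v => f (row_mx ((- t)%:M : 'rV_1) v)))//.
    by apply: eq_iint => v; rewrite (raddfN (@scalar_mx R 1)) -opp_row_mx.
  exact: (@Borel_fun_row_mxl _ 1).
- exact: measurable_iint_row_mx.
- by move=> t; exact: iint_ge0.
Qed.

Lemma le_iint (R : realType) n (f g : 'rV[R]_n -> \bar R) :
  (forall x, 0 <= f x)%E -> Borel_fun f -> Borel_fun g ->
  (forall x, f x <= g x)%E -> (iint f <= iint g)%E.
Proof.
elim: n f g => [|n IH] f g f0 mf mg fg /=; first exact: fg.
apply: ge0_le_integral => //.
- by move=> t _; exact: iint_ge0.
- exact: measurable_iint_row_mx.
- by apply: measurable_iint_row_mx => // x; exact: le_trans (fg x).
- by move=> t _; apply: IH => //; exact: (@Borel_fun_row_mxl _ 1).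
Qed.

(** * Gamma integrals and the layer cake formula *)

Lemma integral_ind_itv (R : realType) (i : interval R) (f : R -> R) :
  (\int[@lebesgue_measure R]_t ((t \in i)%:R * f t)%:E =
   \int[@lebesgue_measure R]_(t in [set` i]) (f t)%:E)%E.
Proof.
rewrite [RHS]integral_mkcond; apply: eq_integral => t _; rewrite patchE.
case: ifPn => [|/negP]; rewrite inE/=; first by move=> ->; rewrite mul1r.
by move=> /negP/negbTE ->; rewrite mul0r.
Qed.

Lemma continuous_expRN (R : realType) : continuous (fun t : R => expR (- t)).
Proof.
move=> t; apply: continuous_comp; last exact: continuous_expR.
exact: opp_continuous.
Qed.

Lemma measurable_expRN (R : realType) (D : set R) :
  measurable_fun D (fun t : R => expR (- t)).
Proof.
have := continuous_measurable_fun (@continuous_expRN R).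
exact: measurable_funS.
Qed.

Lemma measurable_exprn (R : realType) (D : set R) k :
  measurable_fun D (fun t : R => t ^+ k).
Proof.
have := continuous_measurable_fun (@exprn_continuous R k).
exact: measurable_funS.
Qed.

(** The guard [0 < t] changes the integrand only when [a = 0], and then at a single point. It
    confines the layer cake formula to levels [t > 0], where sublevel sets scale. *)
Lemma integral_expRN_tail (R : realType) (a : R) : 0 <= a ->
  (\int[@lebesgue_measure R]_t
     (((0 < t) && (a <= t))%R%:R * expR (- t))%R%:E = (expR (- a)%R)%:E)%E.
Proof.
move=> a0; transitivity
  (\int[@lebesgue_measure R]_(t in `[a, +oo[) (expR (- t)%R)%:E)%E.
  move: a0; rewrite le_eqVlt => /orP[/eqP <-|a0].
    rewrite -integral_itv_obnd_cbnd; last first.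
      exact: ((measurable_EFinP _ _).2 (@measurable_expRN R _)).
    rewrite -integral_ind_itv.
    apply: eq_integral => t _; rewrite in_itv/= andbT.
    by case: (ltP 0 t) => [/ltW ->|].
  rewrite -integral_ind_itv; apply: eq_integral => t _; rewrite in_itv/= andbT.
  by case: (leP a t) => [/(lt_le_trans a0) ->//|]; rewrite andbF.
rewrite (@ge0_continuous_FTC2y _ (fun t => expR (- t)) (fun t => - expR (- t))
  a 0).
- by rewrite -EFinB sub0r opprK.
- by move=> x _; exact: expR_ge0.
- exact/continuous_subspaceT/continuous_expRN.
- by rewrite -oppr0; apply: cvgN; exact: cvgr_expR.
- by move=> x _; exact: ex_derive.
- by apply: cvg_at_right_filter; apply: cvgN; exact: continuous_expRN.
- move=> x _; rewrite derive1E.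
  have H : is_derive x 1 (fun t : R => - expR (- t)) (expR (- x)).
    by apply: is_derive_eq; rewrite mulrN1 opprK.
  exact: derive_val.
Qed.

Lemma integral_exprn (R : realType) (a : R) k : 0 <= a ->
  (\int[@lebesgue_measure R]_t ((0 < t <= a)%R%:R * t ^+ k)%R%:E =
   (a ^+ k.+1 / k.+1%:R)%R%:E)%E.
Proof.
move=> a0.
have cX n : continuous (fun t : R => t ^+ n).
  by move=> t; exact: exprn_continuous.
transitivity (\int[@lebesgue_measure R]_(t in `[0%R, a]) (t ^+ k)%R%:E)%E.
  rewrite -integral_itv_obnd_cbnd//; last first.
    exact: ((measurable_EFinP _ _).2 (@measurable_exprn R _ k)).
  by rewrite -integral_ind_itv; apply: eq_integral => t _; rewrite in_itv.
move: a0; rewrite le_eqVlt => /orP[/eqP <-|a0].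
  by rewrite set_itv1 integral_set1 expr0n mul0r.
have cF : continuous (fun t : R => t ^+ k.+1 / k.+1%:R).
  by move=> t; apply: cvgM; [exact: cX|exact: cvg_cst].
have dF (x : R) : is_derive x 1 (fun t : R => t ^+ k.+1 / k.+1%:R) (x ^+ k).
  have -> : (fun t : R => t ^+ k.+1 / k.+1%:R) =
      k.+1%:R^-1 *: (@id R : R -> R) ^+ k.+1.
    by apply/funext => t; rewrite mulrC !fctE.
  apply: is_derive_eq.
  by rewrite /GRing.scale/= mulr1 mulrA mulVf ?mul1r.
rewrite (@continuous_FTC2 _ _ (fun t => t ^+ k.+1 / k.+1%:R))//.
- by rewrite expr0n mul0r sube0.
- exact: continuous_subspaceT.
- split.
  + by move=> x _; exact: ex_derive.
  + by apply: cvg_at_right_filter; exact: cF.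
  + by apply: cvg_at_left_filter; exact: cF.
- by move=> x _; rewrite derive1E; exact: derive_val.
Qed.

Lemma measurable_ind (d : measure_display) (S : measurableType d) (R : realType)
    (b : S -> bool) :
  measurable_fun setT b -> measurable_fun setT (fun s => (b s)%:R : R).
Proof.
move=> mb; rewrite (_ : (fun _ => _) = (fun s => if b s then 1 else 0)).
  exact: measurable_fun_ifT.
by apply/funext => s; case: (b s).
Qed.

(** Tonelli takes the place of integration by parts: [t^(k+1)] is the integral of [(k+1) s^k] over
    [0 < s <= t], and integrating over [t] first leaves the tail [exp (- s)], hence [k+1] times the
    previous case. *)
Lemma integral_expRN_exprn (R : realType) k :
  (\int[@lebesgue_measure R]_t ((0 < t)%R%:R * (expR (- t) * t ^+ k))%R%:E =
   (k`!%:R)%:E)%E.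
Proof.
elim: k => [|k IH].
  rewrite fact0 (_ : 1%:R = expR (- 0)) ?oppr0 ?expR0// -[in RHS](expR0 R).
  rewrite -[in RHS]oppr0 -(integral_expRN_tail (lexx 0)).
  apply: eq_integral => t _; rewrite expr0 mulr1.
  by case: (ltP 0 t) => [/ltW ->|].
pose H (p : R * R) := (k.+1%:R * ((0 < p.2) && (p.2 <= p.1))%:R *
  (expR (- p.1) * p.2 ^+ k))%:E.
have mH : measurable_fun setT H.
  apply/measurable_EFinP; apply: measurable_funM.
    apply: measurable_funM => //; apply: measurable_ind; apply: measurable_and.
      exact: measurable_fun_ltr.
    exact: measurable_fun_ler.
  apply: measurable_funM.
    apply: (measurableT_comp (f := fun t : R => expR (- t))) => //.
    exact: measurable_expRN.
  exact: measurable_funX.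
have H0 p : (0 <= H p)%E.
  rewrite lee_fin -mulrA mulr_ge0//; case: (ltP 0 p.2) => [p0|];
    last by rewrite mul0r.
  by rewrite !mulr_ge0// ?expR_ge0// exprn_ge0// ltW.
transitivity (\int[@lebesgue_measure R]_t \int[@lebesgue_measure R]_s H (t,
  s))%E.
  apply: eq_integral => t _.
  have [t0|t0] := leP t 0.
    rewrite mul0r; apply/esym/integral0_eq => s _; rewrite /H/=.
    case: (ltP 0 s) => [s0|]; last by rewrite mulr0 mul0r.
    by rewrite leNgt (le_lt_trans t0 s0) mulr0 mul0r.
  transitivity ((k.+1%:R * expR (- t))%:E * \int[@lebesgue_measure R]_s
      ((0 < s <= t)%R%:R * s ^+ k)%R%:E)%E.
    rewrite integral_exprn ?ltW// -EFinM; congr EFin; rewrite mul1r.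
    by rewrite [k.+1%:R * _]mulrC mulrACA divff ?mulr1// pnatr_eq0.
  rewrite -ge0_integralZl//.
  - apply: eq_integral => s _; rewrite -EFinM /H/=; congr EFin; ring.
  - apply/measurable_EFinP/measurable_funM; last exact: measurable_funX.
    apply: measurable_ind; apply: measurable_and.
      exact: measurable_fun_ltr.
    exact: measurable_fun_ler.
  - move=> s _; rewrite lee_fin; case: (ltP 0 s) => [s0|];
      last by rewrite mul0r.
    by rewrite mulr_ge0// exprn_ge0// ltW.
rewrite (fubini_tonelli (m1 := @lebesgue_measure R) (m2 := @lebesgue_measure R)
  H)//.
transitivity (\int[@lebesgue_measure R]_s (k.+1%:R%:E *
    ((0 < s)%R%:R * (expR (- s) * s ^+ k))%R%:E))%E; last first.
  rewrite ge0_integralZl//; first by rewrite IH -EFinM factS natrM.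
  - apply/measurable_EFinP/measurable_funM.
      by apply: measurable_ind; exact: measurable_fun_ltr.
    apply: measurable_funM; last exact: measurable_funX.
    exact: measurable_expRN.
  - move=> s _; rewrite lee_fin; case: (ltP 0 s) => [s0|];
      last by rewrite mul0r.
    by rewrite !mulr_ge0// ?expR_ge0// exprn_ge0// ltW.
apply: eq_integral => s _.
have [s0|s0] := leP s 0.
  rewrite mul0r mule0; apply: integral0_eq => t _.
  by rewrite /H/= ltNge s0 mulr0 mul0r.
rewrite mul1r EFinM -(integral_expRN_tail (ltW s0)).
rewrite [(_ * (s ^+ k)%:E)%E]muleC muleA -EFinM -ge0_integralZl//.
- apply: eq_integral => t _; rewrite -EFinM /H/= s0; congr EFin.
  case: (leP s t) => [/(lt_le_trans s0) -> /=|_]; first by ring.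
  by rewrite !andbF !(mul0r, mulr0).
- apply/measurable_EFinP/measurable_funM.
    apply: measurable_ind; apply: measurable_and.
      exact: measurable_fun_ltr.
    exact: measurable_fun_ler.
  exact: measurable_expRN.
- by rewrite lee_fin mulr_ge0// exprn_ge0// ltW.
Qed.

(** * Borel sets and their volumes *)

Definition Borel_set (R : realType) n (A : set 'rV[R]_n) :=
  Borel_fun (fun x => (\1_A x)%:E).

Lemma mx_ballE (R : realType) n (x y : 'rV[R]_n) e :
  ball x e y <-> 0 < e /\ forall i, `|x 0 i - y 0 i| < e.
Proof.
split=> [[e0 H]|[e0 H]]; split => // i.
  by have := H 0 i; rewrite -ball_normE.
by move=> j; rewrite ord1 -ball_normE; exact: H.
Qed.

Lemma coord_measurable_preimage_open d (S : measurableType d) (R : realType) n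
    (c : S -> 'rV[R]_n) (U : set 'rV[R]_n) :
  coord_measurable c -> open U -> measurable (c @^-1` U).
Proof.
move=> mc oU.
(* Balls with rational centre and radius [1/(k+1)] form a countable family, and for the sup norm
   membership in one is a finite conjunction of conditions on coordinates. Taking [1/(k+1)] below
   [e/2] keeps such a ball around a point of [U] inside [U]. *)
pose B (p : 'rV[rat]_n * nat) : set 'rV[R]_n :=
  ball (map_mx ratr p.1 : 'rV[R]_n) p.2.+1%:R^-1.
pose F p := [set s | B p `<=` U /\ B p (c s)].
have -> : c @^-1` U = \bigcup_p F p.
  apply/seteqP; split => [s Us|s [p _ [BU Bs]]]; last exact: BU.
  have /nbhs_ballP[e /= e0 eU] : nbhs (c s) U by exact: open_nbhs_nbhs.
  have [k] := ltr_add_invr (divr_gt0 e0 (ltr0n R 2)); rewrite add0r => ke.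
  pose dlt : R := k.+1%:R^-1.
  have d0 : 0 < dlt by rewrite invr_gt0.
  have /choice[q qP] : forall i, exists q : rat,
      ratr q \in `]c s 0 i, (c s 0 i + dlt)[.
    by move=> i; apply: rat_in_itvoo; rewrite ltrDl.
  exists (\row_i q i, k) => //; split.
    move=> x /mx_ballE[_ qx]; apply: eU; apply/mx_ballE; split => // i.
    have := qx i; rewrite !mxE -/dlt !ltr_distl => /andP[q1 q2].
    have := qP i; rewrite in_itv/= => /andP[q3 q4].
    by move: ke; rewrite -/dlt => ke; apply/andP; split; lra.
  apply/mx_ballE; split => // i; rewrite !mxE -/dlt.
  have := qP i; rewrite in_itv/= => /andP[q3 q4].
  by rewrite ltr_distl; apply/andP; split; lra.
apply: countable_bigcupT_measurable; first exact: countableP.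
move=> p; have [BU|BU] := pselect (B p `<=` U); last first.
  by rewrite (_ : F p = set0)//; apply/seteqP; split => // s [].
rewrite (_ : F p = \bigcap_(i in [set: 'I_n])
  [set s | `|ratr (p.1 0 i) - c s 0 i| < p.2.+1%:R^-1]); last first.
  apply/seteqP; split => s.
    by move=> [_ /mx_ballE[_ H]] i _; have := H i; rewrite mxE.
  move=> H; split => //; apply/mx_ballE; split; first by rewrite invr_gt0.
  by move=> i; have := H i I; rewrite mxE.
apply: fin_bigcap_measurable => // i _.
rewrite -[X in measurable X]setTI.
have := @measurable_fun_ltr _ S R setT
  (fun s => `|ratr (p.1 0 i) - c s 0 i|) (cst p.2.+1%:R^-1).
have mf : measurable_fun setT (fun s => `|ratr (p.1 0 i) - c s 0 i|).
  apply: measurableT_comp => //; apply: measurable_funB => //; exact: mc.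
move=> /(_ mf (measurable_cst _) measurableT [set true] I).
by congr measurable; congr (_ `&` _).
Qed.

Lemma continuous_coord_measurable d (S : measurableType d) (R : realType) n
    (c : S -> 'rV[R]_n) (f : 'rV[R]_n -> R) :
  continuous f -> coord_measurable c -> measurable_fun setT (fun s => f (c s)).
Proof.
move=> cf mc.
apply: (measurability _ (RGenOpens.measurableE R)).
move=> _ [_ [a [b ->] <-]]; rewrite setTI.
apply: (coord_measurable_preimage_open (U := f @^-1` `]a, b[%classic) mc).
by apply: open_comp => // x _; exact: cf.
Qed.

Lemma closed_Borel_set (R : realType) n (A : set 'rV[R]_n) :
  closed A -> Borel_set A.
Proof.
move=> cA d S c mc; apply/measurable_EFinP.
apply: (measurable_indic (U := c @^-1` A)).
rewrite -[A]setCK preimage_setC; apply: measurableC.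
by apply: (coord_measurable_preimage_open (U := ~` A) mc); exact: closed_openC.
Qed.

(* Layer cake: [exp (- phi x)] is the integral of [exp (- t)] over [t >= phi x]. *)
Lemma iint_expRN (R : realType) n k (phi : 'rV[R]_n -> R) :
  continuous phi -> (forall x, 0 <= phi x) ->
  (forall t, 0 < t -> (vol [set x | (phi x <= t)%R] =
     (t ^+ k)%R%:E * vol [set x | (phi x <= 1)%R])%E) ->
  (iint (fun x => (expR (- phi x))%:E) =
   k`!%:R%:E * vol [set x | (phi x <= 1)%R])%E.
Proof.
move=> cphi phi0 hphi.
pose G (t : R) (x : 'rV[R]_n) : \bar R :=
  (((0 < t) && (phi x <= t))%:R * expR (- t))%:E.
have G0 t x : (0 <= G t x)%E by rewrite lee_fin mulr_ge0// expR_ge0.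
have mG : Borel_kernel G.
  move=> d S a c ma mc; apply/measurable_EFinP; apply: measurable_funM.
    apply: measurable_ind; apply: measurable_and.
      exact: measurable_fun_ltr.
    apply: measurable_fun_ler => //.
    exact: continuous_coord_measurable.
  apply: (measurableT_comp (f := fun t : R => expR (- t))) => //.
  exact: measurable_expRN.
rewrite (eq_iint (g := fun x => \int[@lebesgue_measure R]_t G t x)%E);
  last first.
  by move=> x; rewrite -integral_expRN_tail.
rewrite -integral_iintC//.
transitivity (\int[@lebesgue_measure R]_t (vol [set x | (phi x <= 1)%R] *
    ((0 < t)%R%:R * (expR (- t) * t ^+ k))%R%:E))%E; last first.
  rewrite ge0_integralZl//.
  - by rewrite integral_expRN_exprn muleC.
  - apply/measurable_EFinP/measurable_funM.
      by apply: measurable_ind; exact: measurable_fun_ltr.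
    apply: measurable_funM; last exact: measurable_funX.
    exact: measurable_expRN.
  - move=> t _; rewrite lee_fin; case: (ltP 0 t) => [t0|];
      last by rewrite mul0r.
    by rewrite !mulr_ge0// ?expR_ge0// exprn_ge0// ltW.
  - by rewrite vol_iint; apply: iint_ge0.
apply: eq_integral => t _.
have [t0|t0] := leP t 0.
  rewrite mul0r mule0 (eq_iint (g := fun=> 0 * 0)%E); last first.
    by move=> x; rewrite /G ltNge t0 !mul0r mul0e.
  by rewrite ge0_iintZl ?mul0e// => ? ? ? ? ?; exact: measurable_cst.
rewrite mul1r EFinM muleC -muleA -hphi// vol_iint -ge0_iintZl//.
- by apply: eq_iint => x; rewrite /G t0/= indicE mem_setE/= -EFinM mulrC.
- apply: closed_Borel_set; rewrite (_ : mkset _ = phi @^-1` [set r | r <= t])//.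
  by apply: preimage_closed => // ; exact: closed_le.
Qed.

Lemma iint_row_mxM (R : realType) m n (f : 'rV[R]_m -> \bar R)
    (g : 'rV[R]_n -> \bar R) :
  (forall x, 0 <= f x)%E -> (forall x, 0 <= g x)%E ->
  Borel_fun f -> Borel_fun g ->
  (iint (fun z : 'rV_(m + n) => f (lsubmx z) * g (rsubmx z)) =
   iint f * iint g)%E.
Proof.
move=> f0 g0 mf mg; rewrite iint_add muleC -ge0_iintZl//; last exact: iint_ge0.
apply: eq_iint => x; rewrite muleC -ge0_iintZl//.
by apply: eq_iint => y; rewrite row_mxKl row_mxKr.
Qed.

Lemma vol_setM (R : realType) m n (A : set 'rV[R]_m) (B : set 'rV[R]_n) :
  Borel_set A -> Borel_set B ->
  (vol [set z : 'rV_(m + n) | A (lsubmx z) /\ B (rsubmx z)] = vol A * vol B)%E.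
Proof.
move=> mA mB; rewrite !vol_iint -iint_row_mxM//.
apply: eq_iint => z; rewrite -EFinM !indicE; congr EFin.
rewrite -natrM mulnb; congr ((nat_of_bool _)%:R).
by apply/idP/andP; rewrite !inE.
Qed.

Lemma le_vol (R : realType) n (A B : set 'rV[R]_n) :
  Borel_set A -> Borel_set B -> A `<=` B -> (vol A <= vol B)%E.
Proof.
move=> mA mB AB; rewrite !vol_iint; apply: le_iint => // x.
rewrite lee_fin !indicE ler_nat; case: (boolP (x \in A)) => // /set_mem /AB Bx.
by rewrite mem_set.
Qed.

Lemma vol_scale (R : realType) n (a : R) (A : set 'rV[R]_n) :
  0 < a -> Borel_set A ->
  (vol [set x | A (a^-1 *: x)] = (a ^+ n)%:E * vol A)%E.
Proof.
move=> a0 mA; rewrite !vol_iint.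
rewrite -[X in (X%:E * _)%E]invrK -exprVn -iint_comp_scale ?invr_gt0//.
Qed.

Lemma vol_set0 (R : realType) n : vol (set0 : set 'rV[R]_n) = 0%E.
Proof.
elim: n => [|n IH] /=; first by rewrite indicE in_set0.
by apply: integral0_eq => t _; rewrite -[RHS]IH.
Qed.

Lemma vol_box (R : realType) n (r : R) : 0 < r ->
  vol [set x : 'rV[R]_n | forall i, `|x 0 i| <= r] = ((2 * r) ^+ n)%:E.
Proof.
move=> r0; elim: n => [|n IH] /=.
  by rewrite indicE mem_set//= => -[].
transitivity (\int[@lebesgue_measure R]_t (((2 * r) ^+ n)%R%:E *
    (\1_(`[- r, r]%classic : set R) t)%R%:E))%E; last first.
  rewrite ge0_integralZl//; last by rewrite lee_fin exprn_ge0// mulr_ge0// ltW.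
    rewrite integral_indic// setIT.
    have := @lebesgue_measure_itv R `[- r, r]; rewrite /= lte_fin gtrN// => e.
    by rewrite [X in (_ * X)%E]e -EFinB -EFinM exprSr opprK mulr_natl mulr2n.
  exact/measurable_EFinP/measurable_indic.
apply: eq_integral => t _; rewrite indicE.
have E v : (forall i, `|(row_mx (t%:M : 'rV_1) v) 0 i| <= r :> R) <->
    (t \in (`[- r, r]%classic : set R)) /\ (forall i : 'I_n, `|v 0 i| <= r).
  rewrite inE/= in_itv/= -ler_norml; split => [H|[tr H] i].
    split; first by have := H (lshift n 0); rewrite row_mxEl mxE eqxx.
    by move=> i; have := H (rshift 1 i); rewrite row_mxEr.
  case: (@split_ordP 1 n i) => j ->; last by rewrite row_mxEr.
  by rewrite row_mxEl mxE ord1 eqxx.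
case: (boolP (t \in (`[- r, r]%classic : set R))) => tr.
  rewrite mule1 -IH; congr vol; apply/seteqP; split => v /=.
    by move=> /E[].
  by move=> Hv; apply/E.
rewrite mule0 -(vol_set0 R n); congr vol; apply/seteqP; split => // v /E[].
by rewrite (negbTE tr).
Qed.

(** * Gauges and duality *)

Lemma dotpC (R : realType) n (x y : 'rV[R]_n) : dotp x y = dotp y x.
Proof. by apply: eq_bigr => i _; rewrite mulrC. Qed.

Lemma dotpDl (R : realType) n (x x' y : 'rV[R]_n) :
  dotp (x + x') y = dotp x y + dotp x' y.
Proof. by rewrite -big_split/=; apply: eq_bigr => i _; rewrite mxE mulrDl. Qed.

Lemma dotpZl (R : realType) n a (x y : 'rV[R]_n) :
  dotp (a *: x) y = a * dotp x y.
Proof. by rewrite mulr_sumr; apply: eq_bigr => i _; rewrite mxE mulrA. Qed.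

Lemma dotpNl (R : realType) n (x y : 'rV[R]_n) : dotp (- x) y = - dotp x y.
Proof. by rewrite -scaleN1r dotpZl mulN1r. Qed.

Lemma dotpDr (R : realType) n (x y y' : 'rV[R]_n) :
  dotp x (y + y') = dotp x y + dotp x y'.
Proof. by rewrite dotpC dotpDl ![dotp _ x]dotpC. Qed.

Lemma dotpZr (R : realType) n a (x y : 'rV[R]_n) :
  dotp x (a *: y) = a * dotp x y.
Proof. by rewrite dotpC dotpZl dotpC. Qed.

Lemma dotpNr (R : realType) n (x y : 'rV[R]_n) : dotp x (- y) = - dotp x y.
Proof. by rewrite dotpC dotpNl dotpC. Qed.

Lemma dotp0r (R : realType) n (x : 'rV[R]_n) : dotp x 0 = 0.
Proof. by rewrite -[in LHS](scale0r (0 : 'rV[R]_n)) dotpZr mul0r. Qed.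

Lemma dotp_row_mx (R : realType) m n (a c : 'rV[R]_m) (b d : 'rV[R]_n) :
  dotp (row_mx a b) (row_mx c d) = dotp a c + dotp b d.
Proof.
rewrite /dotp big_split_ord/=; congr (_ + _); apply: eq_bigr => i _.
  by rewrite !row_mxEl.
by rewrite !row_mxEr.
Qed.

Lemma dotp_delta (R : realType) n (x : 'rV[R]_n) i :
  dotp x (delta_mx 0 i) = x 0 i.
Proof.
rewrite /dotp (bigD1 i)//= mxE !eqxx mulr1 big1 ?addr0// => j ji.
by rewrite mxE (negbTE ji) andbF mulr0.
Qed.

Lemma normr_coord_le (R : realType) n (x : 'rV[R]_n) i : `|x 0 i| <= `|x|.
Proof.
rewrite [leRHS]/Num.norm/= mx_normrE.
exact: (le_bigmax _ (fun ij : 'I_1 * 'I_n => `|x ij.1 ij.2|) (0, i)).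
Qed.

(* An even support function; being an attained supremum of linear forms, it is
   automatically a seminorm. *)
Definition gauge (R : realType) n (g : 'rV[R]_n -> R) :=
  (forall x, g (- x) = g x) /\
  forall x, exists a, dotp a x = g x /\ forall z, dotp a z <= g z.

Lemma gauge_ge0 (R : realType) n (g : 'rV[R]_n -> R) x : gauge g -> 0 <= g x.
Proof.
move=> [gN /(_ x)[a [_ ag]]].
by have := ag x; have := ag (- x); rewrite gN dotpNr => ? ?; lra.
Qed.

Lemma gaugeD (R : realType) n (g : 'rV[R]_n -> R) x y :
  gauge g -> g (x + y) <= g x + g y.
Proof.
by move=> [_ /(_ (x + y))[a [<- ag]]]; rewrite dotpDr lerD.
Qed.

Lemma gaugeZ (R : realType) n (g : 'rV[R]_n -> R) r x :
  gauge g -> g (r *: x) = `|r| * g x.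
Proof.
move=> gg; have [gN gs] := gg.
have H s y : 0 <= s -> s * g y <= g (s *: y).
  by move=> s0; have [a [<- ag]] := gs y; rewrite -dotpZr.
have Hp s : 0 < s -> g (s *: x) = s * g x.
  move=> s0; apply/le_anti/andP; split; last exact/H/ltW.
  have := H s^-1 (s *: x); rewrite scalerA mulVf ?gt_eqF// scale1r invr_ge0.
  by move=> /(_ (ltW s0)); rewrite mulrC ler_pdivrMr// mulrC.
have [r0|r0|<-] := ltgtP 0 r; first by rewrite gtr0_norm// Hp.
  by rewrite ltr0_norm// -Hp ?oppr_gt0// scaleNr gN.
rewrite scale0r normr0 mul0r.
by have [a [<- _]] := gs 0; rewrite dotp0r.
Qed.

Lemma gauge0 (R : realType) n (g : 'rV[R]_n -> R) : gauge g -> g 0 = 0.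
Proof. by move=> gg; rewrite -(scale0r 0) gaugeZ// normr0 mul0r. Qed.

(** Testing a supporting form [a] on plus and minus the basis vectors bounds its coefficients by the
    values of [g] there. The summand 1 keeps the constant positive even if all these values
    vanish. *)
Lemma gauge_le_norm (R : realType) n (g : 'rV[R]_n -> R) :
  gauge g -> exists2 C, 0 < C & forall x, g x <= C * `|x|.
Proof.
move=> gg; have [gN gs] := gg.
exists (1 + \sum_(i < n) g (delta_mx 0 i)).
  by rewrite ltr_pwDl// sumr_ge0// => i _; exact: gauge_ge0.
move=> x; have [a [<- ag]] := gs x.
apply: (@le_trans _ _ (\sum_(i < n) g (delta_mx 0 i) * `|x|)); last first.
  by rewrite -mulr_suml ler_wpM2r// lerDr.
apply: ler_sum => i _; apply: le_trans (ler_norm _) _; rewrite normrM.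
apply: ler_pM => //; last exact: normr_coord_le.
have := ag (delta_mx 0 i); have := ag (- delta_mx 0 i).
by rewrite gN dotpNr dotp_delta ler_norml => *; apply/andP; split; lra.
Qed.

Lemma gauge_continuous (R : realType) n (g : 'rV[R]_n -> R) :
  gauge g -> continuous g.
Proof.
move=> gg x; have [C C0 gC] := gauge_le_norm gg.
move=> A /nbhs_ballP[e /= e0 eA]; apply/nbhs_ballP; exists (C^-1 * e) => /=.
  by rewrite mulr_gt0// invr_gt0.
move=> y; rewrite -ball_normE/= ltr_pdivlMl// => xy; apply: eA.
rewrite -ball_normE/=; apply: le_lt_trans (xy).
apply: le_trans (gC (x - y)).
have := gaugeD (x - y) y gg; have := gaugeD (y - x) x gg.
by rewrite !subrK -(opprB x y) gg.1 ler_norml => *; apply/andP; split; lra.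
Qed.

Lemma gauge_closed (R : realType) n (g : 'rV[R]_n -> R) t :
  gauge g -> closed [set x | g x <= t].
Proof.
move=> gg; rewrite (_ : mkset _ = g @^-1` [set r | r <= t])//.
by apply: preimage_closed; [move=> x _;
  exact: gauge_continuous|exact: closed_le].
Qed.

Lemma gauge_interior0 (R : realType) n (g : 'rV[R]_n -> R) :
  gauge g -> ([set x | g x <= 1])° 0.
Proof.
move=> gg; have [C C0 gC] := gauge_le_norm gg.
apply/nbhs_ballP; exists C^-1 => /=; first by rewrite invr_gt0.
move=> x; rewrite -ball_normE/= sub0r normrN => xC.
by apply: le_trans (gC x) _; rewrite -ler_pdivlMl// mulr1 ltW.
Qed.

(** A [gauge] may vanish away from the origin, and its unit ball is then unbounded; the coordinate
    bound excludes this. *)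
Lemma gauge_convex_body (R : realType) n (g : 'rV[R]_n -> R) (C : R) :
  gauge g -> (forall (x : 'rV[R]_n) i, `|x 0 i| <= C * g x) ->
  convex_body [set x | g x <= 1].
Proof.
move=> gg gC; split.
- apply: bounded_closed_compact; last exact: gauge_closed.
  exists `|C|; split => // M CM x /= x1.
  rewrite [leLHS]/Num.norm/= mx_normrE; apply/bigmax_leP; split.
    by rewrite ltW// (le_lt_trans _ CM).
  move=> [j i] _ /=; rewrite ord1; apply: le_trans (gC x i) _.
  apply: le_trans (ltW CM); apply: le_trans (ler_norm _) _.
  by rewrite normrM (ger0_norm (gauge_ge0 x gg)) ler_piMr.
- move=> x y l; rewrite !inE/= => x1 y1.
  apply: le_trans (gaugeD _ _ gg) _; rewrite !gaugeZ//.
  have l0 : 0 <= l%:num by [].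
  have l1 : l%:num <= 1 by [].
  have l1' : 0 <= 1 - l%:num by rewrite subr_ge0.
  rewrite /unstable.onem !ger0_norm//.
  have := mulr_ge0 l0 (eqbRL (subr_ge0 _ _) x1).
  by have := mulr_ge0 l1' (eqbRL (subr_ge0 _ _) y1) => ? ?; lra.
- by exists 0; exact: gauge_interior0.
Qed.

(** The unit ball contains a cube of half-side [1/C]. Positivity is what makes a bound
    [pi^k V < 2^(M+k)] fail for large [k]. *)
Lemma gauge_vol_gt0 (R : realType) n (g : 'rV[R]_n -> R) :
  gauge g -> (0 < vol [set x | (g x <= 1)%R])%E.
Proof.
move=> gg; have [C C0 gC] := gauge_le_norm gg.
have r0 : 0 < C^-1 by rewrite invr_gt0.
apply: (@lt_le_trans _ _ (((2 * C^-1) ^+ n)%R%:E)).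
  by rewrite lte_fin exprn_gt0// mulr_gt0.
rewrite -vol_box//; apply: le_vol.
- apply: closed_Borel_set.
  rewrite (_ : mkset _ = \bigcap_(i in [set: 'I_n])
      ((fun x : 'rV[R]_n => `|x 0 i|) @^-1` [set r | r <= C^-1])).
    apply: closed_bigI => i _; apply: preimage_closed; last exact: closed_le.
    move=> x _; apply: continuous_comp; first exact: coord_continuous.
    exact: norm_continuous.
  by apply/seteqP; split => [x H i _|x H i]; exact: H.
- exact/closed_Borel_set/gauge_closed.
- move=> x /= H; apply: le_trans (gC x) _; rewrite -ler_pdivlMl// mulr1.
  rewrite [leLHS]/Num.norm/= mx_normrE; apply/bigmax_leP; split;
    first exact: ltW.
  by move=> [j i] _ /=; rewrite ord1.
Qed.

Lemma gauge_vol_scale (R : realType) n (g : 'rV[R]_n -> R) t :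
  gauge g -> 0 < t ->
  (vol [set x | (g x <= t)%R] = (t ^+ n)%R%:E * vol [set x | (g x <= 1)%R])%E.
Proof.
move=> gg t0; rewrite -vol_scale//; last exact/closed_Borel_set/gauge_closed.
congr vol; apply/seteqP; split => x /=;
by rewrite gaugeZ// gtr0_norm ?invr_gt0// mulrC ler_pdivrMr// mul1r.
Qed.

Lemma iint_expRN_gauge (R : realType) n (g : 'rV[R]_n -> R) :
  gauge g ->
  (iint (fun x => (expR (- g x))%:E) =
   n`!%:R%:E * vol [set x | (g x <= 1)%R])%E.
Proof.
move=> gg; apply: iint_expRN; first exact: gauge_continuous.
  by move=> x; exact: gauge_ge0.
by move=> t t0; exact: gauge_vol_scale.
Qed.

Lemma gauge_sqr_le1 (R : realType) n (g : 'rV[R]_n -> R) t :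
  gauge g -> [set x | g x ^+ 2 <= t ^+ 2] = [set x | g x <= `|t|].
Proof.
move=> gg; apply/seteqP; split => x /=;
by rewrite -(real_normK (num_real t)) ler_sqr ?nnegrE ?gauge_ge0.
Qed.

(** In dimension [2n] the set where [g^2 <= t] has [t^n] times the volume of the unit ball, so the
    constant is the factorial of [n]; odd dimensions would bring in half-integer values of Gamma. *)
Lemma iint_expRN_gauge2 (R : realType) n (g : 'rV[R]_(n + n) -> R) :
  gauge g ->
  (iint (fun x => (expR (- (g x ^+ 2))%R)%:E) =
   n`!%:R%:E * vol [set x | (g x <= 1)%R])%E.
Proof.
move=> gg; have e1 := gauge_sqr_le1 1 gg; rewrite expr1n normr1 in e1.
rewrite -e1; apply: (iint_expRN (phi := fun x => g x ^+ 2)).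
- move=> x; apply: (continuous_comp (f := g) (g := fun t => t ^+ 2)).
    exact: gauge_continuous.
  exact: exprn_continuous.
- by move=> x; rewrite exprn_ge0// gauge_ge0.
- move=> t t0; rewrite e1 -[in LHS](sqr_sqrtr (ltW t0)) gauge_sqr_le1//.
  rewrite ger0_norm ?sqrtr_ge0// gauge_vol_scale ?sqrtr_gt0//.
  by rewrite exprD -exprMn -expr2 sqr_sqrtr// ltW.
Qed.

(** The unit balls are polar to each other. Stated as a Hölder inequality with attainment on both
    sides, the relation is checked by exhibiting vectors instead of computing suprema. *)
Definition dual_gauges (R : realType) n (g h : 'rV[R]_n -> R) :=
  [/\ gauge g, gauge h, forall x y, dotp x y <= g x * h y,
      forall y, exists x, g x <= 1 /\ dotp x y = h y
    & forall x, exists y, h y <= 1 /\ dotp x y = g x].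

Lemma gauge_of_duality (R : realType) n (g h : 'rV[R]_n -> R) :
  (forall x, 0 <= g x) -> (forall x, g (- x) = g x) ->
  (forall x y, dotp x y <= g x * h y) ->
  (forall x, exists y, h y <= 1 /\ dotp x y = g x) -> gauge g.
Proof.
move=> g0 gN gh gy; split => // x; have [y [y1 <-]] := gy x.
exists y; split; first exact: dotpC.
by move=> z; rewrite dotpC (le_trans (gh z y))// ler_piMr.
Qed.

Lemma dual_gaugesP (R : realType) n (g h : 'rV[R]_n -> R) :
  (forall x, 0 <= g x) -> (forall x, g (- x) = g x) ->
  (forall x, 0 <= h x) -> (forall x, h (- x) = h x) ->
  (forall x y, dotp x y <= g x * h y) ->
  (forall y, exists x, g x <= 1 /\ dotp x y = h y) ->
  (forall x, exists y, h y <= 1 /\ dotp x y = g x) -> dual_gauges g h.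
Proof.
move=> g0 gN h0 hN gh gx hy; split => //.
  exact: (@gauge_of_duality _ _ g h).
apply: (@gauge_of_duality _ _ h g) => //.
  by move=> x y; rewrite dotpC mulrC.
by move=> y; have [x [? <-]] := gx y; exists x; rewrite dotpC.
Qed.

(** The maximum is the gauge of a product of bodies, the sum that of its polar, the l1-sum of the
    polars. The maximum is attained by a dual vector supported in the block with the larger
    gauge. *)
Lemma dual_gauges_sup_sum (R : realType) m n
    (g1 h1 : 'rV[R]_m -> R) (g2 h2 : 'rV[R]_n -> R) :
  dual_gauges g1 h1 -> dual_gauges g2 h2 ->
  dual_gauges
    (fun z : 'rV[R]_(m + n) => Num.max (g1 (lsubmx z)) (g2 (rsubmx z)))
    (fun z => h1 (lsubmx z) + h2 (rsubmx z)).
Proof.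
move=> [gg1 gh1 D1 a1 b1] [gg2 gh2 D2 a2 b2]; apply: dual_gaugesP.
- by move=> z; rewrite le_max gauge_ge0.
- by move=> z; rewrite !linearN/= gg1.1 gg2.1.
- by move=> z; rewrite addr_ge0// gauge_ge0.
- by move=> z; rewrite !linearN/= gh1.1 gh2.1.
- move=> x y; rewrite -[x]hsubmxK -[y]hsubmxK dotp_row_mx !row_mxKl !row_mxKr.
  rewrite mulrDr lerD//.
    by apply: le_trans (D1 _ _) _; rewrite ler_wpM2r ?gauge_ge0// le_max lexx.
  apply: le_trans (D2 _ _) _; rewrite ler_wpM2r ?gauge_ge0// le_max lexx.
  by rewrite orbT.
- move=> y; have [x1 [g1x e1]] := a1 (lsubmx y).
  have [x2 [g2x e2]] := a2 (rsubmx y); exists (row_mx x1 x2).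
  rewrite row_mxKl row_mxKr ge_max g1x g2x -[y in dotp _ y]hsubmxK.
  by rewrite dotp_row_mx e1 e2.
- move=> x; have [y1 [h1y e1]] := b1 (lsubmx x).
  have [y2 [h2y e2]] := b2 (rsubmx x).
  case: (leP (g1 (lsubmx x)) (g2 (rsubmx x))) => _.
    exists (row_mx 0 y2); rewrite row_mxKl row_mxKr gauge0// add0r.
    by rewrite -[x in dotp x _]hsubmxK dotp_row_mx dotp0r add0r.
  exists (row_mx y1 0); rewrite row_mxKl row_mxKr gauge0// addr0.
  by rewrite -[x in dotp x _]hsubmxK dotp_row_mx dotp0r addr0.
Qed.

Lemma Borel_fun_expRN_gauge (R : realType) n (g : 'rV[R]_n -> R) :
  gauge g -> Borel_fun (fun x => (expR (- g x))%:E).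
Proof.
move=> gg d S c mc; apply/measurable_EFinP.
apply: (measurableT_comp (f := fun t : R => expR (- t))).
  exact: measurable_expRN.
exact/(continuous_coord_measurable (gauge_continuous gg)).
Qed.

Lemma Borel_fun_expRN_gauge2 (R : realType) n (g : 'rV[R]_n -> R) :
  gauge g -> Borel_fun (fun x => (expR (- (g x ^+ 2)))%:E).
Proof.
move=> gg d S c mc; apply/measurable_EFinP.
apply: (measurableT_comp (f := fun t : R => expR (- t))).
  exact: measurable_expRN.
exact/measurable_funX/(continuous_coord_measurable (gauge_continuous gg)).
Qed.

Lemma vol_gauge_max (R : realType) m n
    (g1 : 'rV[R]_m -> R) (g2 : 'rV[R]_n -> R) :
  gauge g1 -> gauge g2 ->
  (vol [set z : 'rV_(m + n) |
     (Num.max (g1 (lsubmx z)) (g2 (rsubmx z)) <= 1)%R] =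
   vol [set x | (g1 x <= 1)%R] * vol [set x | (g2 x <= 1)%R])%E.
Proof.
move=> gg1 gg2; rewrite -vol_setM; last 2 first.
- exact/closed_Borel_set/gauge_closed.
- exact/closed_Borel_set/gauge_closed.
congr vol; apply/seteqP; split => z /=; first by rewrite ge_max => /andP.
by rewrite ge_max => -[-> ->].
Qed.

Lemma vol_gauge_add (R : realType) m n
    (g1 : 'rV[R]_m -> R) (g2 : 'rV[R]_n -> R) :
  gauge g1 -> gauge g2 ->
  gauge (fun z : 'rV_(m + n) => g1 (lsubmx z) + g2 (rsubmx z)) ->
  ((m + n)`!%:R%:E * vol [set z : 'rV_(m + n) |
     (g1 (lsubmx z) + g2 (rsubmx z) <= 1)%R] =
   (m`!%:R%:E * vol [set x | (g1 x <= 1)%R]) *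
   (n`!%:R%:E * vol [set x | (g2 x <= 1)%R]))%E.
Proof.
move=> gg1 gg2 gg; rewrite -!iint_expRN_gauge// -iint_row_mxM//; last 2 first.
- exact: Borel_fun_expRN_gauge.
- exact: Borel_fun_expRN_gauge.
by apply: eq_iint => z; rewrite -EFinM -expRD opprD.
Qed.

(** * Gauges of symplectically self-polar bodies *)

Definition self_polar_gauge (R : realType) n (g : 'rV[R]_(n + n) -> R) :=
  [/\ gauge g, forall x y, omega x y <= g x * g y
    & forall y, exists x, g x <= 1 /\ omega x y = g y].

Lemma omega_row_mx (R : realType) n (q p q' p' : 'rV[R]_n) :
  omega (row_mx q p) (row_mx q' p') = dotp q p' - dotp p q'.
Proof. by rewrite /omega !row_mxKl !row_mxKr. Qed.

Lemma omega_dotp (R : realType) n (x y : 'rV[R]_(n + n)) :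
  omega x y = dotp x (row_mx (rsubmx y) (- lsubmx y)).
Proof.
by rewrite -[x in dotp x _]hsubmxK dotp_row_mx dotpNr.
Qed.

Lemma omegaC (R : realType) n (x y : 'rV[R]_(n + n)) : omega x y = - omega y x.
Proof.
by rewrite /omega opprB [dotp (lsubmx y) _]dotpC [dotp (rsubmx y) _]dotpC.
Qed.

Lemma omegaDr (R : realType) n (x y y' : 'rV[R]_(n + n)) :
  omega x (y + y') = omega x y + omega x y'.
Proof. by rewrite /omega !linearD/= !dotpDr opprD addrACA. Qed.

Lemma omegaZr (R : realType) n a (x y : 'rV[R]_(n + n)) :
  omega x (a *: y) = a * omega x y.
Proof. by rewrite /omega !linearZ/= !dotpZr mulrBr. Qed.

Lemma omegaNr (R : realType) n (x y : 'rV[R]_(n + n)) :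
  omega x (- y) = - omega x y.
Proof. by rewrite -scaleN1r omegaZr mulN1r. Qed.

Lemma omegaZl (R : realType) n a (x y : 'rV[R]_(n + n)) :
  omega (a *: x) y = a * omega x y.
Proof. by rewrite omegaC omegaZr -mulrN -omegaC. Qed.

Lemma self_polar_gaugeP (R : realType) n (g : 'rV[R]_(n + n) -> R) :
  (forall x, 0 <= g x) -> (forall x, g (- x) = g x) ->
  (forall x y, omega x y <= g x * g y) ->
  (forall y, exists x, g x <= 1 /\ omega x y = g y) -> self_polar_gauge g.
Proof.
move=> g0 gN go gx; split => //.
(* The quarter turn [J] converts [omega] into the dot product, so self-polarity says that [g] and
   [g] composed with [J] are dual in the ordinary sense. *)
pose J (y : 'rV[R]_(n + n)) := row_mx (- rsubmx y) (lsubmx y).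
have E x y : dotp x y = omega x (J y).
  by rewrite omega_dotp /J row_mxKl row_mxKr opprK hsubmxK.
apply: (@gauge_of_duality _ _ g (fun y => g (J y))) => //.
  by move=> x y; rewrite E.
move=> x; have [u [u1 <-]] := gx x.
exists (row_mx (- rsubmx u) (lsubmx u)); rewrite E.
have -> : J (row_mx (- rsubmx u) (lsubmx u)) = - u.
  by rewrite /J row_mxKl row_mxKr -opp_row_mx hsubmxK.
rewrite gN; split => //.
by rewrite omegaNr -omegaC.
Qed.

(** The coordinate [x_i] equals [omega x (J e_i)], which is at most [g x * g (J e_i)]. *)
Lemma self_polar_gauge_coord (R : realType) n (g : 'rV[R]_(n + n) -> R) :
  self_polar_gauge g ->
  exists C, forall (x : 'rV[R]_(n + n)) i, `|x 0 i| <= C * g x.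
Proof.
move=> [gg go _].
pose J (y : 'rV[R]_(n + n)) := row_mx (- rsubmx y) (lsubmx y).
have E x y : dotp x y = omega x (J y).
  by rewrite omega_dotp /J row_mxKl row_mxKr opprK hsubmxK.
exists (\sum_(i < n + n) g (J (delta_mx 0 i))) => x i.
apply: (@le_trans _ _ (g (J (delta_mx 0 i)) * g x)); last first.
  rewrite ler_wpM2r ?gauge_ge0// (bigD1 i)//= lerDl sumr_ge0// => j _.
  exact: gauge_ge0.
have := go x (J (delta_mx 0 i)); have := go (- x) (J (delta_mx 0 i)).
rewrite -!E gg.1 dotpNl dotp_delta ler_norml => *; apply/andP; split; lra.
Qed.

Lemma self_polar_gauge_body (R : realType) n (g : 'rV[R]_(n + n) -> R) :
  self_polar_gauge g ->
  convex_body [set x | g x <= 1] /\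
  symplectically_self_polar [set x | g x <= 1].
Proof.
move=> gs; have [gg go gx] := gs; split.
  by have [C gC] := self_polar_gauge_coord gs; exact: gauge_convex_body gC.
split; first exact: gauge_interior0.
apply/seteqP; split => y /=.
  move=> y1 x /= x1; apply: le_trans (go x y) _.
  by rewrite mulr_ile1// gauge_ge0.
by move=> H; have [x [x1 <-]] := gx y; exact: H.
Qed.

(** * Sums in the l2 sense *)

Definition hypot (R : realType) (a b : R) := Num.sqrt (a ^+ 2 + b ^+ 2).

Lemma hypot_ge0 (R : realType) (a b : R) : 0 <= hypot a b.
Proof. exact: sqrtr_ge0. Qed.

Lemma sqr_hypot (R : realType) (a b : R) : hypot a b ^+ 2 = a ^+ 2 + b ^+ 2.
Proof. by rewrite sqr_sqrtr// addr_ge0// sqr_ge0. Qed.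

Lemma hypot_le1 (R : realType) (a b : R) :
  (hypot a b <= 1) = (a ^+ 2 + b ^+ 2 <= 1).
Proof.
by rewrite -sqr_hypot -[in RHS](expr1n _ 2) ler_sqr ?nnegrE ?hypot_ge0.
Qed.

Lemma hypotN (R : realType) (a b : R) : hypot (- a) (- b) = hypot a b.
Proof. by rewrite /hypot !sqrrN. Qed.

Lemma hypotC (R : realType) (a b : R) : hypot a b = hypot b a.
Proof. by rewrite /hypot addrC. Qed.

Lemma hypot_eq0 (R : realType) (a b : R) : hypot a b = 0 -> a = 0 /\ b = 0.
Proof.
move=> ab0; have := sqr_hypot a b; rewrite ab0 expr0n/= => /esym/eqP.
by rewrite paddr_eq0 ?sqr_ge0// !sqrf_eq0 => /andP[/eqP -> /eqP ->].
Qed.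

Lemma hypot_cauchy (R : realType) (a b c d : R) :
  a * c + b * d <= hypot a b * hypot c d.
Proof.
rewrite -sqrtrM ?addr_ge0 ?sqr_ge0//; apply: le_trans (ler_norm _) _.
rewrite -sqrtr_sqr; apply: ler_wsqrtr; rewrite -subr_ge0.
by rewrite (_ : _ - _ = (a * d - b * c) ^+ 2) ?sqr_ge0//; ring.
Qed.

(** [omega] pairs the q-block of one vector with the p-block of the other, so in each term [g] meets
    [h] and duality applies; the Cauchy-Schwarz inequality in the plane joins the two terms. *)
Lemma dual_gauges_hypot (R : realType) n (g h : 'rV[R]_n -> R) :
  dual_gauges g h ->
  self_polar_gauge (fun z => hypot (g (lsubmx z)) (h (rsubmx z))).
Proof.
move=> [gg gh D a b]; apply: self_polar_gaugeP.
- by move=> z; exact: hypot_ge0.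
- by move=> z; rewrite !linearN/= gg.1 gh.1.
- move=> x y; rewrite [X in _ <= _ * X]hypotC.
  apply: le_trans (hypot_cauchy _ _ _ _).
  apply: lerD; first exact: D.
  by rewrite -dotpNl dotpC mulrC -(gh.1 (rsubmx x)); exact: D.
- move=> y; set N := hypot _ _.
  have [N0|N0] := eqVneq N 0.
    exists 0; rewrite !linear0 !gauge0// /hypot expr0n addr0 sqrtr0 ler01 N0.
    by rewrite /omega !linear0 [dotp 0 _]dotpC [X in _ - X]dotpC !dotp0r subr0.
  have [q [q1 qE]] := a (rsubmx y); have [p [p1 pE]] := b (lsubmx y).
  set s := h (rsubmx y) in qE; set r := g (lsubmx y) in pE.
  have Npos : 0 < N by rewrite lt_neqAle eq_sym N0 hypot_ge0.
  have NE : N ^+ 2 = r ^+ 2 + s ^+ 2 by rewrite sqr_hypot.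
  have r0 : 0 <= r by exact: gauge_ge0.
  have s0 : 0 <= s by exact: gauge_ge0.
  (* The equality case of Cauchy-Schwarz fixes the weights [s / N] and [r / N]; the minus sign is
     that of the second term of [omega]. *)
  exists (row_mx ((s / N) *: q) (- (r / N) *: p)); split.
    rewrite row_mxKl row_mxKr !gaugeZ// hypot_le1 normrN.
    rewrite !ger0_norm ?divr_ge0 ?hypot_ge0//.
    have gq0 := gauge_ge0 q gg; have hp0 := gauge_ge0 p gh.
    apply: (@le_trans _ _ ((s / N) ^+ 2 + (r / N) ^+ 2)).
      have H (c e : R) : 0 <= c -> 0 <= e -> e <= 1 -> (c * e) ^+ 2 <= c ^+ 2.
        by move=> c0 e0 e1; rewrite ler_sqr ?nnegrE ?mulr_ge0// ler_piMr.
      by apply: lerD; apply: H => //; rewrite divr_ge0// ltW.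
    by rewrite !expr_div_n -mulrDl addrC -NE divff// expf_neq0.
  rewrite -{1}[y]hsubmxK omega_row_mx !dotpZl qE [dotp p _]dotpC pE.
  apply: (mulIf N0); rewrite -expr2 NE; by field.
Qed.

Lemma vol_dual_gauges_hypot (R : realType) n (g h : 'rV[R]_(n + n) -> R) :
  dual_gauges g h ->
  ((n + n)`!%:R%:E * vol [set z : 'rV_((n + n) + (n + n)) |
     (hypot (g (lsubmx z)) (h (rsubmx z)) <= 1)%R] =
   (n`!%:R%:E * vol [set x | (g x <= 1)%R]) *
   (n`!%:R%:E * vol [set x | (h x <= 1)%R]))%E.
Proof.
move=> gh; have [gg hh _ _ _] := gh; have [G _ _] := dual_gauges_hypot gh.
rewrite -!iint_expRN_gauge2// -iint_row_mxM//; last 2 first.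
- exact: Borel_fun_expRN_gauge2.
- exact: Borel_fun_expRN_gauge2.
by apply: eq_iint => z; rewrite sqr_hypot -EFinM -expRD opprD.
Qed.

(** * The l2-sum with a disc *)

(** The symplectic direct sum of a plane with [R^(2m)]. As all q-coordinates precede all
    p-coordinates, those of the plane are inserted at the heads of the two halves. *)
Definition plane_sum (R : realType) m (a b : R) (w : 'rV[R]_(m + m)) :
    'rV[R]_(m.+1 + m.+1) :=
  row_mx (row_mx (a%:M : 'rV_1) (lsubmx w)) (row_mx (b%:M : 'rV_1) (rsubmx w)).

Definition plane_q (R : realType) m (z : 'rV[R]_(m.+1 + m.+1)) : R :=
  lsubmx (lsubmx z : 'rV_(1 + m)) 0 0.

Definition plane_p (R : realType) m (z : 'rV[R]_(m.+1 + m.+1)) : R :=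
  lsubmx (rsubmx z : 'rV_(1 + m)) 0 0.

Definition plane_rest (R : realType) m (z : 'rV[R]_(m.+1 + m.+1)) :
    'rV[R]_(m + m) :=
  row_mx (rsubmx (lsubmx z : 'rV_(1 + m))) (rsubmx (rsubmx z : 'rV_(1 + m))).

Lemma plane_rest_linear (R : realType) m : linear (@plane_rest R m).
Proof.
by move=> a x y; rewrite /plane_rest !linearP/= scale_row_mx add_row_mx.
Qed.

HB.instance Definition _ (R : realType) m :=
  GRing.isLinear.Build R _ _ _ (@plane_rest R m) (@plane_rest_linear R m).

Lemma plane_sumK (R : realType) m (a b : R) (w : 'rV[R]_(m + m)) :
  [/\ plane_q (plane_sum a b w) = a, plane_p (plane_sum a b w) = b
    & plane_rest (plane_sum a b w) = w].
Proof.
rewrite /plane_q /plane_p /plane_rest /plane_sum row_mxKl row_mxKr.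
rewrite !(@row_mxKl _ _ 1 m) !(@row_mxKr _ _ 1 m) hsubmxK.
by rewrite !mxE eqxx !mulr1n.
Qed.

Lemma plane_sumE (R : realType) m (z : 'rV[R]_(m.+1 + m.+1)) :
  z = plane_sum (plane_q z) (plane_p z) (plane_rest z).
Proof.
rewrite /plane_sum /plane_rest row_mxKl row_mxKr /plane_q /plane_p.
by rewrite -!mx11_scalar !(@hsubmxK _ _ 1 m) hsubmxK.
Qed.

Lemma omega_plane_sum (R : realType) m (a b a' b' : R) (w w' : 'rV[R]_(m + m)) :
  omega (plane_sum a b w) (plane_sum a' b' w') = a * b' - b * a' + omega w w'.
Proof.
rewrite /plane_sum omega_row_mx !(@dotp_row_mx _ 1 m) /omega.
rewrite {1}/dotp {2}/dotp !big_ord1 !mxE eqxx !mulr1n.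
by rewrite opprD addrACA.
Qed.

Definition disc_sum (R : realType) m (g : 'rV[R]_(m + m) -> R)
    (z : 'rV[R]_(m.+1 + m.+1)) : R :=
  hypot (hypot (plane_q z) (plane_p z)) (g (plane_rest z)).

Lemma plane_sumN (R : realType) m (a b : R) (w : 'rV[R]_(m + m)) :
  - plane_sum a b w = plane_sum (- a) (- b) (- w).
Proof. by rewrite /plane_sum opp_row_mx !(@opp_row_mx _ 1 1 m) !raddfN. Qed.

Lemma disc_sumE (R : realType) m (g : 'rV[R]_(m + m) -> R) a b w :
  disc_sum g (plane_sum a b w) = hypot (hypot a b) (g w).
Proof. by rewrite /disc_sum; have [-> -> ->] := plane_sumK a b w. Qed.

Lemma self_polar_disc_sum (R : realType) m (g : 'rV[R]_(m + m) -> R) :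
  self_polar_gauge g -> self_polar_gauge (disc_sum g).
Proof.
move=> [gg D a]; apply: self_polar_gaugeP.
- by move=> z; exact: hypot_ge0.
- move=> z; rewrite [z]plane_sumE plane_sumN !disc_sumE hypotN.
  by rewrite gg.1.
- move=> x y; rewrite [x]plane_sumE [y]plane_sumE omega_plane_sum !disc_sumE.
  apply: le_trans (hypot_cauchy _ _ _ _); apply: lerD; last exact: D.
  apply: le_trans (_ : _ <= hypot (plane_q x) (plane_p x) *
    hypot (plane_p y) (- plane_q y)) _.
    by apply: le_trans (hypot_cauchy _ _ _ _); rewrite mulrN.
  by rewrite [X in _ * X <= _]hypotC /hypot sqrrN.
- move=> y; rewrite [y]plane_sumE disc_sumE.
  set c := plane_q y; set d := plane_p y; set w := plane_rest y.
  have [u [u1 uE]] := a w; set N := hypot _ _.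
  have g0 : 0 <= g w by exact: gauge_ge0.
  have [N0|N0] := eqVneq N 0.
    have [/hypot_eq0[-> ->] _] := hypot_eq0 N0.
    exists (plane_sum 0 0 0);
      rewrite disc_sumE omega_plane_sum !mul0r subrr add0r.
    rewrite gauge0// /hypot !(expr0n, addr0, sqrtr0) ler01 N0.
    by rewrite /omega !linear0 [dotp 0 _]dotpC [X in _ - X]dotpC !dotp0r subr0.
  have Npos : 0 < N by rewrite lt_neqAle eq_sym N0 hypot_ge0.
  have NE : N ^+ 2 = c ^+ 2 + d ^+ 2 + g w ^+ 2 by rewrite sqr_hypot sqr_hypot.
  (* Again equality in Cauchy-Schwarz: the plane component of [y] turned by a right angle, and a
     maximiser [u] for the rest weighted by [g w], all divided by [N]. *)
  exists (plane_sum (d / N) (- c / N) ((g w / N) *: u)); split.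
    rewrite disc_sumE hypot_le1 sqr_hypot gaugeZ//.
    rewrite (ger0_norm (divr_ge0 g0 (ltW Npos))).
    apply: (@le_trans _ _ ((d / N) ^+ 2 + (- c / N) ^+ 2 + (g w / N) ^+ 2)).
      rewrite lerD2l ler_sqr ?nnegrE ?mulr_ge0 ?invr_ge0 ?(ltW Npos)
        ?gauge_ge0//.
      by rewrite ler_piMr// divr_ge0// ltW.
    rewrite !expr_div_n sqrrN -!mulrDl (addrC (d ^+ 2)) -NE divff//.
    by rewrite expf_neq0.
  rewrite omega_plane_sum omega_dotp dotpZl -omega_dotp uE.
  by apply: (mulIf N0); rewrite -expr2 NE; field.
Qed.

Lemma integral_expRN_sqr (R : realType) :
  (\int[@lebesgue_measure R]_t (expR (- (t ^+ 2))%R)%:E =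
   (Num.sqrt pi)%:E)%E.
Proof. exact: integralT_gauss. Qed.

Lemma measurable_expRN_sqr (R : realType) :
  measurable_fun setT (fun t : R => (expR (- (t ^+ 2)))%:E).
Proof. apply/measurable_EFinP; exact: (@measurable_gauss_fun R). Qed.

Lemma vol_disc_sum (R : realType) m (g : 'rV[R]_(m + m) -> R) :
  self_polar_gauge g ->
  ((m.+1)`!%:R%:E * vol [set z | (disc_sum g z <= 1)%R] =
   pi%:E * (m`!%:R%:E * vol [set x | (g x <= 1)%R]))%E.
Proof.
move=> gs; have [gg _ _] := gs; have [G _ _] := self_polar_disc_sum gs.
rewrite -iint_expRN_gauge2// -iint_expRN_gauge2// iint_add /=.
pose E (t : R) : \bar R := (expR (- (t ^+ 2)))%:E.
have E0 t : (0 <= E t)%E by rewrite lee_fin expR_ge0.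
pose W (q p : 'rV[R]_m) := (expR (- (g (row_mx q p) ^+ 2)))%:E.
have W0 q p : (0 <= W q p)%E by rewrite lee_fin expR_ge0.
have mg := Borel_fun_expRN_gauge2 gg.
have mW q : Borel_fun (W q) by exact: (@Borel_fun_row_mxl _ m m _ q mg).
(* The order of integration is [a], [q], [b], [p]. The integrand factors, so the Gauss integrals
   over [a] and [b] can be pulled out as constants, each contributing [sqrt pi]. *)
transitivity (\int[@lebesgue_measure R]_a iint (fun q : 'rV[R]_m =>
    \int[@lebesgue_measure R]_b (E a * (E b * iint (W q)))))%E.
  apply: eq_integral => a _; apply: eq_iint => q; apply: eq_integral => b _.
  rewrite -ge0_iintZl// -ge0_iintZl//; last first.
  - move=> d S c mc; apply: emeasurable_funM => //; exact: mW.
  - by move=> x; exact: mule_ge0.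
  apply: eq_iint => p; rewrite -/(plane_sum a b (row_mx q p)).
  have -> : row_mx (row_mx a%:M q) (row_mx b%:M p) = plane_sum a b (row_mx q p).
    by rewrite /plane_sum row_mxKl row_mxKr.
  rewrite disc_sumE !sqr_hypot /E /W -!EFinM -!expRD -!opprD.
  by rewrite addrA.
have mI : Borel_fun (fun q => iint (W q)).
  move=> d S c mc; apply: measurable_iint => // d' S' a c' ma mc'.
  apply: (mg _ _ (fun s => row_mx (c (a s)) (c' s))).
  apply: coord_measurable_row_mx => // i.
  exact: (measurableT_comp (mc i)).
have I0 q : (0 <= iint (W q))%E by exact: iint_ge0.
have mE := @measurable_expRN_sqr R.
set sp : \bar R := (Num.sqrt pi)%:E.
have sp0 : (0 <= sp)%E by rewrite lee_fin sqrtr_ge0.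
transitivity (\int[@lebesgue_measure R]_a (E a * (sp * iint (fun q => iint (W
  q)))))%E.
  apply: eq_integral => a _; rewrite -ge0_iintZl// -ge0_iintZl//; last first.
  - by move=> d S c mc; apply: emeasurable_funM => //; exact: mI.
  - by move=> q; exact: mule_ge0.
  apply: eq_iint => q; rewrite ge0_integralZl//; last 2 first.
  - by apply: emeasurable_funM.
  - by move=> t _; exact: mule_ge0.
  congr (_ * _)%E; under eq_integral do rewrite muleC.
  by rewrite ge0_integralZl// integral_expRN_sqr muleC.
under eq_integral do rewrite muleC.
rewrite ge0_integralZl//; last by rewrite mule_ge0// iint_ge0.
rewrite integral_expRN_sqr muleC muleA -EFinM -expr2 sqr_sqrtr ?pi_ge0//.
by congr (_ * _)%E; rewrite [RHS]iint_add.
Qed.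

(** Reduction along the q-axis of the plane: its symplectic orthogonal is [p = 0], and the quotient
    forgets [q]. Forgetting [q] does not increase the gauge, while every [w] lifts with plane
    component 0 and the same gauge. *)
Lemma disc_sum_reduction (R : realType) m (g : 'rV[R]_(m + m) -> R) :
  gauge g ->
  linear_symplectic_reduction [set z | disc_sum g z <= 1] [set w | g w <= 1].
Proof.
move=> gg; pose v : 'rV[R]_(m.+1 + m.+1) := plane_sum 1 0 0.
have orthE y : symplectic_orth <[v]>%VS y <-> plane_p y = 0.
  have vy : omega v y = plane_p y.
    rewrite [y]plane_sumE omega_plane_sum mul1r mul0r subr0.
    have [_ -> _] := plane_sumK (plane_q y) (plane_p y) (plane_rest y).
    by rewrite /omega !linear0 [dotp 0 _]dotpC [X in _ - X]dotpC !dotp0r subr0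
      addr0.
  split; first by move=> /(_ v (memv_line v)); rewrite vy.
  by move=> y0 x /vlineP[k ->]; rewrite omegaZl vy y0 mulr0.
have vE k : k *: v = plane_sum k 0 0.
  rewrite /v /plane_sum scale_row_mx !(@scale_row_mx _ 1 1 m) !scale_scalar_mx.
  by rewrite mulr1 mulr0 !linear0.
exists <[v]>%VS, (@plane_rest R m); split.
- move=> x y /vlineP[k ->] /vlineP[l ->].
  rewrite !vE omega_plane_sum mulr0 mul0r subrr add0r.
  by rewrite /omega !linear0 !dotp0r subrr.
- split.
  + move=> x /orthE x0; split=> [r0|/vlineP[k ->]].
      by apply/vlineP; exists (plane_q x); rewrite vE [LHS]plane_sumE x0 r0.
    by rewrite vE; have [_ _] := plane_sumK k 0 (0 : 'rV[R]_(m + m)).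
  + apply/seteqP; split => // w _; have [_ p0 r0] := plane_sumK 0 0 w.
    by exists (plane_sum 0 0 w) => //; apply/orthE.
  + move=> x y /orthE x0 /orthE y0.
    rewrite [in RHS](plane_sumE x) [in RHS](plane_sumE y) omega_plane_sum x0 y0.
    by rewrite mulr0 mul0r subrr add0r.
- apply/seteqP; split => [w /= w1|_ [z [/= z1 _] <-]].
    have [_ p0 r0] := plane_sumK 0 0 w.
    exists (plane_sum 0 0 w) => //; split; last exact/orthE.
    rewrite /= disc_sumE hypot_le1 sqr_hypot expr0n !add0r.
    by rewrite expr_le1// gauge_ge0.
  have := z1; rewrite /disc_sum hypot_le1 => {}z1.
  rewrite -(@expr_le1 _ 2)// ?gauge_ge0//; apply: le_trans z1.
  by rewrite lerDr sqr_ge0.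
Qed.

(** * Separation and symmetric bodies *)

Lemma convex_setP (R : realType) n (K : set 'rV[R]_n) x y t :
  convex_set K -> K x -> K y -> 0 <= t -> t <= 1 ->
  K (t *: x + (1 - t) *: y).
Proof.
move=> cK Kx Ky t0 t1; pose l := Itv01 t0 t1.
by have /set_mem := cK x y l (mem_set Kx) (mem_set Ky).
Qed.

Lemma continuous_dotp (R : realType) n (T : topologicalType)
    (f g : T -> 'rV[R]_n) :
  (forall i, continuous (fun x => f x 0 i)) ->
  (forall i, continuous (fun x => g x 0 i)) ->
  continuous (fun x => dotp (f x) (g x)).
Proof.
move=> cf cg; apply: continuous_big => [p|i _ x]; first exact: add_continuous.
by apply: (@continuousM _ T (fun x => f x 0 i) (fun x => g x 0 i));
  [exact: cf|exact: cg].
Qed.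

Lemma dotp_gt0 (R : realType) n (x : 'rV[R]_n) : x != 0 -> 0 < dotp x x.
Proof.
move=> x0; rewrite lt_neqAle eq_sym sumr_ge0 ?andbT; last first.
  by move=> i _; rewrite -expr2 sqr_ge0.
apply: contra x0; rewrite psumr_eq0; last by move=> i _; rewrite -expr2 sqr_ge0.
move=> /allP H; apply/eqP/rowP => i; rewrite mxE.
by have := H i (mem_index_enum _); rewrite mulf_eq0 orbb => /eqP.
Qed.

(* [u] points from the nearest point of [K] to [z]. *)
Lemma strict_separation (R : realType) n (K : set 'rV[R]_n) z :
  compact K -> convex_set K -> K !=set0 -> ~ K z ->
  exists u, forall x, K x -> dotp x u < dotp z u.
Proof.
move=> cK vK K0 Kz.
have cphi : {within K, continuous (fun x : 'rV[R]_n => dotp (z - x) (z - x))}.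
  apply: continuous_subspaceT.
  have cz i : continuous (fun x : 'rV[R]_n => (z - x) 0 i).
    move=> x; under eq_fun do rewrite !mxE.
    apply: (@continuousB _ _ _ (cst (z 0 i)) (fun x : 'rV[R]_n => x 0 i)).
      exact: cst_continuous.
    exact: coord_continuous.
  exact: continuous_dotp.
have [c /set_mem Kc cmin] := EVT_min_rV K0 cK cphi.
exists (z - c) => x Kx.
have u0 : z - c != 0.
  by apply/eqP => /subr0_eq zc; apply: Kz; rewrite zc.
have := dotp_gt0 u0; set u := z - c => uu.
suff : dotp (x - c) u <= 0.
  have -> : x - c = (x - z) + u by rewrite /u addrA subrK.
  by rewrite dotpDl dotpDl dotpNl => ?; lra.
rewrite leNgt; apply/negP => s0.
have [d dE] : exists d, d = x - c by exists (x - c).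
rewrite -dE in s0; set s := dotp d u in s0; set D := dotp d d.
have D0 : 0 <= D by apply: sumr_ge0 => i _; rewrite -expr2 sqr_ge0.
have sD : 0 < s + D by rewrite ltr_pwDl.
(* The squared distance from [z] at parameter [t] is [uu - 2 t s + t^2 D]. This [t] lies in [(0, 1]]
   and satisfies [t D < s], so the point would be closer to [z] than the nearest point [c]. *)
pose t := s / (s + D).
have t0 : 0 < t by rewrite divr_gt0.
have t1 : t <= 1 by rewrite ler_pdivrMr// mul1r lerDl.
have Kt : K (t *: x + (1 - t) *: c) by apply: convex_setP => //; exact: ltW.
have := cmin _ (mem_set Kt).
have -> : z - (t *: x + (1 - t) *: c) = u + (- t) *: d.
  rewrite dE /u scalerBl scale1r scalerBr !scaleNr opprK !opprD !opprK.
  by rewrite -!addrA; congr (_ + _); rewrite addrCA.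
rewrite -/u; clearbody u.
rewrite !(dotpDl, dotpDr, dotpZl, dotpZr) [dotp u d]dotpC -/s -/D => H.
have tE : t * (s + D) = s by rewrite /t divfK// gt_eqF.
have : s * 2 <= t * D by rewrite -(ler_pM2l t0); lra.
by nra.
Qed.

Lemma compact_dotp_max (R : realType) n (K : set 'rV[R]_n) y :
  compact K -> K !=set0 ->
  exists x, K x /\ forall x', K x' -> dotp x' y <= dotp x y.
Proof.
move=> cK K0.
have cphi : {within K, continuous (fun x : 'rV[R]_n => dotp x y)}.
  apply: continuous_subspaceT.
  apply: (continuous_dotp (f := id) (g := fun=> y)) => i x.
    exact: coord_continuous.
  exact: cst_continuous.
have [c /set_mem Kc cmax] := EVT_max_rV K0 cK cphi.
by exists c; split => // x' /mem_set /cmax.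
Qed.

Lemma polar_closed (R : realType) n (K : set 'rV[R]_n) : closed (polar K).
Proof.
rewrite (_ : polar K = \bigcap_(x in K) [set y | dotp x y <= 1]).
  apply: closed_bigI => x _.
  rewrite (_ : mkset _ = (dotp x) @^-1` [set r | r <= 1])//.
  apply: preimage_closed; last exact: closed_le.
  move=> y _; apply: (continuous_dotp (f := fun=> x) (g := id)) => i z.
    exact: cst_continuous.
  exact: coord_continuous.
by apply/seteqP; split=> y.
Qed.

(** Averaging a ball in [K] with its reflection through the origin gives a ball of the same radius
    centred at 0. *)
Lemma symmetric_body_ball (R : realType) n (K : set 'rV[R]_n) :
  convex_body K -> centrally_symmetric K ->
  exists2 r : R, 0 < r & forall u : 'rV[R]_n, `|u| < r -> K u.
Proof.
move=> [_ vK [x0 /nbhs_ballP[r /= r0 rK]]] sK; exists r => // u ur.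
have KN x : K x -> K (- x) by rewrite {2}sK => Kx; exists x.
have h0 : 0 <= (2^-1 : R) by rewrite invr_ge0.
have h1 : (2^-1 : R) <= 1 by rewrite invf_le1// ler1n.
have -> : u = 2^-1 *: (x0 + u) + (1 - 2^-1) *: (- (x0 - u)).
  have -> : 1 - 2^-1 = 2^-1 :> R by lra.
  rewrite -scalerDr opprB [u - x0]addrC addrACA subrr add0r.
  have -> : u + u = 2 *: u by rewrite scaler_nat mulr2n.
  by rewrite scalerA mulVf ?scale1r.
apply: convex_setP => //; last apply: KN; apply: rK; rewrite -ball_normE/=.
  by rewrite opprD addrA subrr sub0r normrN.
by rewrite subKr.
Qed.

Lemma polar_compact (R : realType) n (K : set 'rV[R]_n) r : 0 < r ->
  (forall u : 'rV[R]_n, `|u| < r -> K u) -> compact (polar K).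
Proof.
move=> r0 rK; apply: bounded_closed_compact; last exact: polar_closed.
have r2 : 0 < r / 2 by rewrite divr_gt0.
exists (r / 2)^-1; split; first exact: num_real.
move=> M CM y /= Py.
rewrite [leLHS]/Num.norm/= mx_normrE; apply/bigmax_leP; split.
  by rewrite ltW// (lt_trans _ CM)// invr_gt0.
move=> [j i] _ /=; rewrite ord1; apply: le_trans (ltW CM).
have dn s : `|s| = 1 -> K ((s * (r / 2)) *: delta_mx 0 i).
  move=> s1; apply: rK; rewrite normrZ normrM s1 mul1r gtr0_norm//.
  apply: (@le_lt_trans _ _ (r / 2));
    last by rewrite ltr_pdivrMr// ltr_pMr// ltr1n.
  apply: ler_piMr; first exact: ltW.
  rewrite [leLHS]/Num.norm/= mx_normrE; apply/bigmax_leP; split => //.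
  move=> [a b] _ /=; rewrite mxE; case: (_ && _); by rewrite ?normr1 ?normr0.
have := Py _ (dn 1 (normr1 _)); have := Py _ (dn (-1) (normrN1 _)).
rewrite !dotpZl dotpC dotp_delta mul1r mulN1r => H1 H2.
rewrite -(ler_pM2l r2) mulfV ?gt_eqF// -{1}(gtr0_norm r2) -normrM ler_norml.
by apply/andP; split; lra.
Qed.

(** Both gauges are defined as support functions, [h] of [K] and [g] of the polar, with maxima
    attained by compactness. That the unit ball of [g] is [K] again is the bipolar theorem, where
    separation enters. *)
Lemma symmetric_body_dual_gauges (R : realType) n (K : set 'rV[R]_n) :
  convex_body K -> centrally_symmetric K ->
  exists g h, [/\ dual_gauges g h, K = [set x | g x <= 1]
                & polar K = [set y | h y <= 1]].
Proof.
move=> bK sK; have [r r0 rK] := symmetric_body_ball bK sK.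
have [cK vK _] := bK.
have KN x : K x -> K (- x) by rewrite {2}sK => Kx; exists x.
have K0 : K 0 by apply: rK; rewrite normr0.
have cP := polar_compact r0 rK.
have PN y : polar K y -> polar K (- y).
  by move=> Py x /KN Kx; rewrite dotpNr -dotpNl; exact: Py.
have P0 : polar K 0 by move=> x _; rewrite dotp0r.
have /choice[f fP] : forall y, exists x, K x /\
    forall x', K x' -> dotp x' y <= dotp x y.
  by move=> y; apply: compact_dotp_max => //; exists 0.
have /choice[e eP] : forall x, exists y, polar K y /\
    forall y', polar K y' -> dotp y' x <= dotp y x.
  by move=> y; apply: compact_dotp_max => //; exists 0.
pose h y := dotp (f y) y; pose g x := dotp (e x) x.
have hle y x : K x -> dotp x y <= h y by exact: (fP y).2.
have gle x y : polar K y -> dotp x y <= g x by rewrite dotpC; exact: (eP x).2.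
have hP y : polar K y <-> h y <= 1.
  split=> [Py|h1 x Kx]; first exact/Py/(fP y).1.
  exact: le_trans (hle _ _ Kx) h1.
have h0 y : 0 <= h y by have := hle y _ K0; rewrite dotpC dotp0r.
have g0 x : 0 <= g x by have := gle x _ P0; rewrite dotp0r.
have gK x : K x -> g x <= 1 by move=> Kx; rewrite /g dotpC; exact: (eP x).1.
have Kg x : g x <= 1 -> K x.
  move=> g1; apply: contrapT => Kx.
  have [u uP] := strict_separation cK vK (ex_intro _ 0 K0) Kx.
  have hu : h u < dotp x u by exact/uP/(fP u).1.
  have := h0 u; set c := h u in hu *; set d := dotp x u in hu => c0.
  (* The midpoint is positive even if [c = 0]; it puts [u / s] in the polar, while [u / s] still
     pairs with [x] to more than 1. *)
  pose s := (c + d) / 2.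
  have s0 : 0 < s by rewrite /s; lra.
  have /gle : polar K (s^-1 *: u).
    move=> x' Kx'; rewrite dotpZr ler_pdivrMl// mulr1.
    by apply: le_trans (hle u x' Kx') _; rewrite -/c /s; lra.
  move=> /(_ x); rewrite dotpZr -/d ler_pdivrMl// => H.
  have : d <= s by apply: le_trans H _; rewrite ler_piMr// ltW.
  by rewrite /s; lra.
exists g, h; split; last 2 first.
- by apply/seteqP; split => x /=; [exact: gK|exact: Kg].
- by apply/seteqP; split => y /= /hP.
apply: dual_gaugesP => //.
- have gN x : g (- x) <= g x.
    by rewrite {1}/g dotpNr -dotpNl dotpC; apply/gle/PN/(eP _).1.
  by move=> x; apply/le_anti; rewrite gN -{1}[x]opprK gN.
- have hN y : h (- y) <= h y.
    by rewrite {1}/h dotpNr -dotpNl; apply/hle/KN/(fP _).1.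
  by move=> y; apply/le_anti; rewrite hN -{1}[y]opprK hN.
(* If [h y = 0], all positive multiples of [y] lie in the polar, and were the pairing positive, the
   one pairing with [x] to [g x + 1] would contradict the maximality of [g x]. Otherwise [y / h y]
   lies in the polar. *)
- move=> x y; have := h0 y; rewrite le_eqVlt => /orP[/eqP hy|hy].
    rewrite -hy mulr0 leNgt; apply/negP => d0.
    have : polar K (((g x + 1) / dotp x y) *: y).
      move=> x' Kx'; rewrite dotpZr; apply: (@le_trans _ _ 0) => //.
      apply: mulr_ge0_le0; first by rewrite divr_ge0 ?addr_ge0// ltW.
      by have := hle y x' Kx'; rewrite -hy.
    by move=> /(gle x); rewrite dotpZr divfK ?gt_eqF//; lra.
  rewrite -ler_pdivrMr// mulrC -dotpZr; apply: gle => x' Kx'.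
  by rewrite dotpZr ler_pdivrMl// mulr1; exact: hle.
- by move=> y; exists (f y); split => //; exact/gK/(fP y).1.
- move=> x; exists (e x); rewrite [in RHS]/g dotpC; split => //.
  exact/hP/(eP x).1.
Qed.

(** * Reductions of self-polar bodies *)

Lemma mx_norm_le (R : realType) n (x : 'rV[R]_n) c :
  0 <= c -> (forall i, `|x 0 i| <= c) -> `|x| <= c.
Proof.
move=> c0 H; rewrite [leLHS]/Num.norm/= mx_normrE; apply/bigmax_leP;
  split => //.
by move=> [j i] _ /=; rewrite ord1.
Qed.

Lemma dotp_le_norm (R : realType) n (x y : 'rV[R]_n) :
  `|dotp x y| <= n%:R * (`|x| * `|y|).
Proof.
apply: le_trans (ler_norm_sum _ _ _) _.
apply: (@le_trans _ _ (\sum_(i < n) `|x| * `|y|)).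
  by apply: ler_sum => i _; rewrite normrM ler_pM// normr_coord_le.
by rewrite sumr_const card_ord mulr_natl.
Qed.

Lemma dotp_mx (R : realType) n (x y : 'rV[R]_n) : dotp x y = (x *m y^T) 0 0.
Proof. by rewrite mxE; apply: eq_bigr => i _; rewrite mxE. Qed.

Lemma dotp_linearl (R : realType) m n (f : {linear 'rV[R]_m -> 'rV[R]_n}) x u :
  dotp (f x) u = dotp x (u *m (lin1_mx f)^T).
Proof. by rewrite !dotp_mx -(mul_rV_lin1 f) trmx_mul trmxK mulmxA. Qed.

Lemma linear_rV_continuous (R : realType) m n
    (f : {linear 'rV[R]_m -> 'rV[R]_n}) : continuous f.
Proof.
have [C C0 fC] : exists2 C : R, 0 < C & forall x, `|f x| <= C * `|x|.
  exists (1 + \sum_i `|f (delta_mx 0 i)|); first by rewrite ltr_pwDl// sumr_ge0.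
  move=> x; rewrite {1}(row_sum_delta x) linear_sum.
  apply: le_trans (ler_norm_sum _ _ _) _.
  apply: (@le_trans _ _ (\sum_i `|f (delta_mx 0 i)| * `|x|)).
    apply: ler_sum => i _; rewrite linearZ normrZ mulrC ler_wpM2l//.
    exact: normr_coord_le.
  by rewrite -mulr_suml ler_wpM2r// lerDr.
move=> x A /nbhs_ballP[e /= e0 eA]; apply/nbhs_ballP; exists (C^-1 * e) => /=.
  by rewrite mulr_gt0// invr_gt0.
move=> y; rewrite -ball_normE/= ltr_pdivlMl// => xy; apply: eA.
by rewrite -ball_normE/= -linearB; apply: le_lt_trans (xy); exact: fC.
Qed.

Lemma symplectically_self_polarN (R : realType) n (X : set 'rV[R]_(n + n)) x :
  X = symplectic_polar X -> X x -> X (- x).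
Proof.
move=> XE Xx; rewrite XE => y Xy; rewrite omegaNr -omegaC.
by move: Xy; rewrite {1}XE; exact.
Qed.

(** Pairing by [omega] with [(-p, q)] is the dot product with [(q, p)], so the polar is the preimage
    of [Y] under [(q, p) -> (-p, q)]: an exchange of blocks, handled by Tonelli, and a reflection of
    one block. *)
Lemma vol_polar_self_polar (R : realType) n (Y : set 'rV[R]_(n + n)) :
  closed Y -> Y = symplectic_polar Y -> vol (polar Y) = vol Y.
Proof.
move=> cY YE.
have mY := closed_Borel_set cY.
pose F (a b : 'rV[R]_n) : \bar R := (\1_Y (row_mx a b))%:E.
have F0 a b : (0 <= F a b)%E by rewrite lee_fin.
have -> : polar Y = [set z | Y (row_mx (- rsubmx z) (lsubmx z))].
  apply/seteqP; split => z /=.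
    move=> Pz; rewrite YE => x Yx; rewrite omega_dotp row_mxKl row_mxKr opprK.
    by rewrite hsubmxK; exact: Pz.
  rewrite {1}YE => Pz x Yx; have := Pz x Yx.
  by rewrite omega_dotp row_mxKl row_mxKr opprK hsubmxK.
have mF : Borel_fun (fun z : 'rV[R]_(n + n) => F (- rsubmx z) (lsubmx z)).
  move=> d S c mc;
    apply: (mY _ _ (fun s => row_mx (- rsubmx (c s)) (lsubmx (c s)))).
  apply: coord_measurable_row_mx => i; under eq_fun do rewrite !mxE.
    by apply: measurableT_comp => //; exact: mc.
  exact: mc.
rewrite !vol_iint.
transitivity (iint (fun x => iint (fun y => F (- y) x))).
  rewrite iint_add; apply: eq_iint => x; apply: eq_iint => y.
  rewrite /F !indicE; congr ((nat_of_bool _)%:R%:E).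
  by apply/idP/idP; rewrite !inE /= row_mxKl row_mxKr.
have := iintC (f := fun z : 'rV[R]_(n + n) => F (- rsubmx z) (lsubmx z)).
move=> /(_ (fun z => F0 _ _) mF) H.
transitivity (iint (fun x => iint (fun y : 'rV[R]_n =>
    F (- rsubmx (row_mx x y)) (lsubmx (row_mx x y))))).
  by apply: eq_iint => x; apply: eq_iint => y; rewrite row_mxKl row_mxKr.
rewrite H; transitivity (iint (fun y => iint (F (- y)))).
  by apply: eq_iint => x; apply: eq_iint => y; rewrite row_mxKl row_mxKr.
rewrite (iint_compN (f := fun y => iint (F y))); first by rewrite iint_add.
- by move=> x; exact: iint_ge0.
- move=> d S c mc; apply: measurable_iint => // d' S' a c' ma mc'.
  apply: (mY _ _ (fun s => row_mx (c (a s)) (c' s))).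
  apply: coord_measurable_row_mx => // i.
  exact: (measurableT_comp (mc i)).
Qed.

Lemma symplectic_orth_closed (R : realType) n
    (V : {vspace 'rV[R]_(n + n)}) : closed (symplectic_orth V).
Proof.
rewrite (_ : symplectic_orth V =
    \bigcap_(x in [set x | x \in V]) [set y | omega x y = 0]); last first.
  by apply/seteqP; split => y.
apply: closed_bigI => x _.
rewrite (_ : mkset _ = omega x @^-1` [set r | r = 0])//.
apply: preimage_closed; last exact: closed_eq.
have -> : omega x = fun y => dotp y (row_mx (- rsubmx x) (lsubmx x)).
  apply/funext => y; rewrite omegaC omega_dotp -dotpNr.
  by rewrite opp_row_mx opprK.
move=> y _; apply: (continuous_dotp (f := id)) => i z.
  exact: coord_continuous.
exact: cst_continuous.
Qed.

(** The inclusion of the polar in [Y] is the substantial one. A lift [w] of a point outside [Y] is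
    separated from [X] modulo [V]; the separating functional is itself represented by a vector of
    the orthogonal of [V] that rescales into [X], and its image in [Y] violates polarity. *)
Lemma reduction_self_polar (R : realType) n m (X : set 'rV[R]_(n + n))
    (Y : set 'rV[R]_(m + m)) :
  convex_body X -> symplectically_self_polar X ->
  linear_symplectic_reduction X Y -> Y = symplectic_polar Y.
Proof.
move=> [cX vX _] [iX XE] [V [f [isoV [fker fsurj fomega] YE]]].
have X0 : X 0 by exact: nbhs_singleton iX.
have VW v : v \in V -> symplectic_orth V v by move=> Vv x Vx; exact: isoV.
have XX x y : X x -> X y -> omega x y <= 1.
  by move=> Xx; rewrite {1}XE; exact.
apply/seteqP; split => y.
  rewrite YE => -[w [Xw Ww] <-] _ [w' [Xw' Ww'] <-].
  by rewrite fomega//; exact: XX.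
move=> Py; have [w Ww wy] : (f @` symplectic_orth V) y by rewrite fsurj.
(* The kernel of [L] is exactly [V], so [L] models the quotient by [V] inside the ambient space. *)
pose L : 'End('rV[R]_(n + n)) := (\1 - projv V)%VF.
have LE x : L x = x - projv V x by rewrite add_lfunE opp_lfunE id_lfunE.
have L0 v : v \in V -> L v = 0 by move=> Vv; rewrite LE projv_id// subrr.
have [[x Xx Lx]|nL] := pselect ((L @` X) (L w)).
  have Vxw : x - w \in V.
    have : L (x - w) = 0 by apply/eqP; rewrite linearB subr_eq0; exact/eqP.
    by rewrite LE => /subr0_eq ->; exact: memv_proj.
  rewrite YE; exists x.
    split => //; rewrite -(subrK w x) => v Vv.
    by rewrite omegaDr (isoV _ _ Vv Vxw) add0r; exact: Ww.
  rewrite -wy; apply/eqP; rewrite -subr_eq0 -linearB; apply/eqP.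
  exact/(fker _ (VW _ Vxw)).
have cLX : compact (L @` X).
  by apply: continuous_compact => //; apply: continuous_subspaceT;
    exact: linear_rV_continuous.
have vLX : convex_set (L @` X : set 'rV[R]_(n + n)).
  move=> _ _ l /set_mem[a Xa <-] /set_mem[b Xb <-]; apply/mem_set.
  exists (l%:num *: a + (1 - l%:num) *: b); last by rewrite linearD !linearZ.
  exact: convex_setP.
have [u uP] := strict_separation cLX vLX (ex_intro _ _ (imageP L X0)) nL.
(* The separating functional factors through [L], hence vanishes on [V]; its [omega]-representative
   [c] therefore lies in the orthogonal of [V]. *)
have [c cE] : exists c, forall x, dotp (L x) u = omega x c.
  exists (row_mx (- rsubmx (u *m (lin1_mx L)^T)) (lsubmx (u *m (lin1_mx L)^T))).
  by move=> x; rewrite dotp_linearl omega_dotp row_mxKl row_mxKr opprK hsubmxK.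
have Wc : symplectic_orth V c.
  by move=> v Vv; rewrite -cE L0// dotpC dotp0r.
have [xm [[x Xx <-] xmax]] := compact_dotp_max u cLX (ex_intro _ _ (imageP L
  X0)).
have := uP _ (imageP L Xx); have := xmax _ (imageP L X0).
rewrite !cE => M0 Mw.
have {}M0 : 0 <= omega x c.
  by move: M0; rewrite -(scale0r (0 : 'rV[R]_(n + n))) omegaZl mul0r.
(* Strictly between the maximum over [X] and the value at [w], hence positive: [c / s] is in [X] by
   self-polarity, yet [omega w (c / s)] exceeds 1. *)
pose s := (omega x c + omega w c) / 2.
have s0 : 0 < s by rewrite /s; lra.
have Xc : X (s^-1 *: c).
  rewrite XE => z Xz; rewrite omegaZr ler_pdivrMl// mulr1 -cE.
  by apply: le_trans (xmax _ (imageP L Xz)) _; rewrite cE /s; lra.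
have Xcn : X (- (s^-1 *: c)) by exact: symplectically_self_polarN.
have Wcn : symplectic_orth V (- (s^-1 *: c)).
  by move=> v Vv; rewrite omegaNr omegaZr Wc// mulr0 oppr0.
have : Y (f (- (s^-1 *: c))) by rewrite YE; exists (- (s^-1 *: c)).
move=> /Py; rewrite -wy fomega// omegaC omegaNr opprK omegaZr.
by rewrite ler_pdivrMl// mulr1 /s; move: Mw; clear; lra.
Qed.

Lemma reduction_convex_body (R : realType) n m (X : set 'rV[R]_(n + n))
    (Y : set 'rV[R]_(m + m)) :
  convex_body X -> symplectically_self_polar X ->
  linear_symplectic_reduction X Y -> convex_body Y.
Proof.
move=> bX sX red; have YE := reduction_self_polar bX sX red.
have [cX vX _] := bX; have [V [f [isoV _ Yf]]] := red.
have cY : compact Y.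
  rewrite Yf; apply: continuous_compact.
    by apply: continuous_subspaceT; exact: linear_rV_continuous.
  by apply: compact_closedI => //; exact: symplectic_orth_closed.
split => //.
  rewrite Yf => _ _ l /set_mem[a [Xa Wa] <-] /set_mem[b [Xb Wb] <-].
  apply/mem_set; exists (l%:num *: a + (1 - l%:num) *: b).
    split; first exact: convex_setP.
    by move=> v Vv; rewrite omegaDr !omegaZr Wa// Wb// !mulr0 addr0.
  by rewrite linearD !linearZ.
have [M M0 YM] : exists2 M : R, 0 < M & forall y, Y y -> `|y| <= M.
  have [M [_ MY]] := compact_bounded cY; exists (`|M| + 1).
    by rewrite ltr_wpDl.
  by move=> y Yy; apply: (MY (`|M| + 1)) => //; rewrite ltr_pwDr// ler_norm.
exists 0; apply/nbhs_ballP.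
(* The interior point comes from self-polarity: on the bounded set [Y], every [z] of norm below
   [1/N] satisfies [omega y z <= 1]. *)
pose N := 1 + (m + m)%:R * M.
have N0 : 0 < N by rewrite ltr_pwDl// mulr_ge0// ltW.
exists N^-1 => /=; first by rewrite invr_gt0.
move=> z; rewrite -ball_normE/= sub0r normrN => zN; rewrite YE => y Yy.
rewrite omega_dotp; apply: le_trans (ler_norm _) _.
apply: le_trans (dotp_le_norm _ _) _.
apply: (@le_trans _ _ ((m + m)%:R * (M * N^-1))); last first.
  by rewrite mulrA ler_pdivrMr// mul1r /N lerDr.
rewrite ler_wpM2l// ler_pM//; first exact: YM.
apply: mx_norm_le; first by rewrite invr_ge0 ltW.
move=> i; rewrite mxE; case: (fintype.split i) => j; rewrite !mxE ?normrN;
exact: le_trans (normr_coord_le _ _) (ltW zN).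
Qed.

Lemma fact_double_le m : ((m + m)`! <= 4 ^ m * m`! ^ 2)%N.
Proof.
elim: m => [//|m IH]; rewrite addSn addnS !factS.
have := leq_mul (leqnn ((m + m).+2 * (m + m).+1)) IH.
rewrite -!mulnA => /leq_trans; apply.
rewrite [leqRHS](_ : _ = (m.+1 * 2) * (m.+1 * 2) * (4 ^ m * m`! ^ 2))%N.
  by rewrite mulnA leq_mul2r; apply/orP; right; apply: leq_mul; lia.
by rewrite expnS !expnMn; ring.
Qed.

(** The lower bound [4^m / (2m+1)] for the central binomial coefficient; [2m+1] is the loss that the
    doublings must absorb. *)
Lemma fact_double_ge m : (4 ^ m * m`! ^ 2 <= (m + m).+1`!)%N.
Proof.
elim: m => [//|m IH];
  rewrite addSn addnS [(m + m).+3`!]factS [(m + m).+2`!]factS mulnA.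
apply: leq_trans (leq_mul (leqnn _) IH).
rewrite factS [leqLHS](_ : _ = (m.+1 * 2) * (m.+1 * 2) * (4 ^ m * m`! ^ 2))%N.
  by rewrite leq_mul2r; apply/orP; right; apply: leq_mul; lia.
by rewrite expnS !expnMn; ring.
Qed.

Lemma reduction_vol_bound (R : realType) n m (X : set 'rV[R]_(n + n))
    (Y : set 'rV[R]_(m + m)) :
  (forall k : nat, (1 <= k)%N -> forall K : set 'rV[R]_k,
      convex_body K -> centrally_symmetric K ->
      ((4 ^+ k / k`!%:R)%:E <= vol K * vol (polar K))%E) ->
  (0 < m)%N -> convex_body X -> symplectically_self_polar X ->
  linear_symplectic_reduction X Y ->
  ((2 ^+ m / m`!%:R)%:E <= vol Y)%E.
Proof.
move=> mahler m0 bX sX red; have YE := reduction_self_polar bX sX red.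
have bY := reduction_convex_body bX sX red.
have cY : closed Y by apply: compact_closed; [exact: norm_hausdorff|case: bY].
have sY : centrally_symmetric Y.
  apply/seteqP; split => [y Yy|_ [y Yy <-]];
    last exact: symplectically_self_polarN.
  by exists (- y); rewrite ?opprK//; exact: symplectically_self_polarN.
have := mahler (m + m)%N (leq_trans m0 (leq_addr _ _)) Y bY sY.
rewrite (vol_polar_self_polar cY YE).
have : (0 <= vol Y)%E by rewrite vol_iint; apply: iint_ge0 => x;
  rewrite lee_fin.
case: (vol Y) => [v|_ _|//]; last by rewrite leey.
rewrite -EFinM !lee_fin => v0 H.
have q0 : 0 <= 2 ^+ m / m`!%:R :> R by rewrite divr_ge0// exprn_ge0.
rewrite -(@ler_sqr _ (2 ^+ m / m`!%:R)) ?nnegrE// [leRHS]expr2.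
apply: le_trans H; rewrite expr_div_n -exprM mulnC exprM (_ : 2 ^+ 2 = 4)//.
  rewrite ler_pdivlMr ?ltr0n ?fact_gt0// mulrAC ler_pdivrMr; last first.
    by rewrite exprn_gt0// ltr0n fact_gt0.
  rewrite exprD -mulrA ler_wpM2l ?exprn_ge0//.
  by rewrite -!natrX -natrM ler_nat fact_double_le.
by rewrite -natrX.
Qed.

(** * Asymptotics *)

Lemma bernoulli_ineq (R : realType) (x : R) k :
  0 <= x -> 1 + k%:R * x <= (1 + x) ^+ k.
Proof.
move=> x0; elim: k => [|k IH]; first by rewrite mul0r addr0 expr0.
rewrite exprS; apply: (@le_trans _ _ ((1 + x) * (1 + k%:R * x))).
  rewrite -[k.+1%:R]natr1 -subr_ge0.
  by rewrite (_ : _ - _ = k%:R * x * x) ?mulr_ge0//; ring.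
by rewrite ler_wpM2l// addr_ge0.
Qed.

(* With [d = sqrt c] and [1 / d = 1 + e], Bernoulli gives
   [c ^ k <= (1 + k e) ^ - 2], which beats a linear factor. *)
Lemma expr_linear_lt1 (R : realType) (c : R) n : 0 <= c -> c < 1 ->
  exists2 j : nat, (0 < j)%N & c ^+ (2 ^ j) * ((n * 2 ^ j)%:R + 1) < 1.
Proof.
rewrite le_eqVlt => /orP[/eqP <- _|c0 c1].
  by exists 1%N => //; rewrite expr0n mul0r.
pose d := Num.sqrt c.
have d0 : 0 < d by rewrite sqrtr_gt0.
have d1 : d < 1 by rewrite -sqrtr1 ltr_sqrt.
have dc : d ^+ 2 = c by rewrite sqr_sqrtr// ltW.
pose e := d^-1 - 1.
have e0 : 0 < e by rewrite subr_gt0 invf_gt1.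
(* Once [2^j] exceeds [n / e^2], the product [n k] is below [(k e)^2] for [k = 2^j]. The successor
   ensures [0 < j], so that one doubling can be split off later. *)
pose j := (Num.bound (n%:R / e ^+ 2)).+1.
have jP : n%:R < (2 ^ j)%:R * e ^+ 2.
  rewrite -ltr_pdivrMr ?exprn_gt0//.
  have b0 : 0 <= n%:R / e ^+ 2 by rewrite divr_ge0// exprn_ge0// ltW.
  apply: lt_le_trans (archi_boundP b0) _; rewrite ler_nat.
  by rewrite (leq_trans (leqnSn _))// -/j ltnW// ltn_expl.
exists j => //; set k := (2 ^ j)%N in jP *.
have k0 : 0 < k%:R :> R by rewrite ltr0n expn_gt0.
have B := bernoulli_ineq k (ltW e0).
have B0 : 0 < 1 + k%:R * e by rewrite ltr_pwDl// mulr_ge0// ltW.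
have E : (1 + e) * d = 1 by rewrite /e addrC subrK mulVf// gt_eqF.
have cE : c ^+ k * ((1 + e) ^+ k) ^+ 2 = 1.
  by rewrite -dc -!exprM ![(_ * 2)%N]mulnC [in X in _ * X]mulnC -[(2 *
    k)%N]mulnC
    -exprMn mulrC E expr1n.
have ck0 : 0 < c ^+ k by rewrite exprn_gt0.
rewrite -cE ltr_pM2l//; apply: (@lt_le_trans _ _ ((1 + k%:R * e) ^+ 2));
  last first.
  by rewrite ler_sqr ?nnegrE// ltW// (lt_le_trans B0).
have : (n * k)%:R < k%:R * (k%:R * e ^+ 2) :> R.
  by rewrite natrM mulrC ltr_pM2l.
have := mulr_gt0 k0 e0; move: (n * k)%N => N; nra.
Qed.

(** Equality would give [cos 1 = cos (pi / 2) = 0], whereas [cos 1] is positive. *)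
Lemma pi_gt2 (R : realType) : 2 < pi :> R.
Proof.
rewrite lt_neqAle pi_ge2 andbT; apply/eqP => e.
have [_ ] := @pihalf_02_cos_pihalf R.
rewrite -e divff ?pnatr_eq0// => c0.
by have := @cos1_gt0 R; rewrite c0 ltxx.
Qed.

Lemma dual_gauges_double (R : realType) M (g h : 'rV[R]_M -> R) (c : R) :
  dual_gauges g h ->
  (M`!%:R%:E * (vol [set x | (g x <= 1)%R] * vol [set x | (h x <= 1)%R]) =
    (c * 4 ^+ M)%R%:E)%E ->
  exists g' h' : 'rV[R]_(M + M) -> R, dual_gauges g' h' /\
  ((M + M)`!%:R%:E * (vol [set x | (g' x <= 1)%R] * vol [set x | (h' x <= 1)%R])
    = (c ^+ 2 * 4 ^+ (M + M))%R%:E)%E.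
Proof.
move=> gh E; have D := dual_gauges_sup_sum gh gh; do 2 eexists; split;
  first exact: D.
have [gg hh _ _ _] := gh; have [_ hh' _ _ _] := D.
rewrite vol_gauge_max// muleCA vol_gauge_add//.
set a := vol _; set b := vol _; set f : \bar R := (M`!%:R)%:E.
transitivity ((f * (a * b)) * (f * (a * b)))%E.
  by rewrite muleACA [(a * (f * b))%E]muleCA.
by rewrite E -EFinM; congr EFin; rewrite exprD; ring.
Qed.

Lemma dual_gauges_iter_double (R : realType) n (g h : 'rV[R]_n -> R) (c : R) j :
  dual_gauges g h ->
  (n`!%:R%:E * (vol [set x | (g x <= 1)%R] * vol [set x | (h x <= 1)%R]) =
    (c * 4 ^+ n)%R%:E)%E ->
  exists M, exists g' h' : 'rV[R]_M -> R,
  [/\ M = (n * 2 ^ j)%N, dual_gauges g' h' &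
  (M`!%:R%:E * (vol [set x | (g' x <= 1)%R] * vol [set x | (h' x <= 1)%R]) =
    (c ^+ (2 ^ j) * 4 ^+ M)%R%:E)%E].
Proof.
move=> gh E; elim: j => [|j [M [g' [h' [ME D EM]]]]].
  by exists n, g, h; rewrite expn0 muln1 expr1.
have [g2 [h2 [D2 E2]]] := dual_gauges_double D EM.
exists (M + M)%N, g2, h2; split => //; first by rewrite expnS; lia.
by rewrite E2 -exprM expnS mulnC.
Qed.

Lemma small_self_polar_gauge (R : realType) n (g h : 'rV[R]_n -> R) (c : R) :
  (0 < n)%N -> dual_gauges g h -> 0 <= c -> c < 1 ->
  (n`!%:R%:E * (vol [set x | (g x <= 1)%R] * vol [set x | (h x <= 1)%R]) =
    (c * 4 ^+ n)%R%:E)%E ->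
  exists M, exists G : 'rV[R]_(M + M) -> R,
  [/\ (0 < M)%N, self_polar_gauge G &
  (M`!%:R%:E * vol [set x | (G x <= 1)%R] < (2 ^+ M)%R%:E)%E].
Proof.
move=> n0 gh c0 c1 E.
(* The last of the [j.+1] doublings is done separately, so that the dimension has the form [M + M]
   required for the l2-sum. *)
have [[//|j] _ jP] := expr_linear_lt1 n c0 c1.
have [M [g1 [h1 [ME D1 E1]]]] := dual_gauges_iter_double j gh E.
have [g2 [h2 [D2 E2]]] := dual_gauges_double D1 E1.
have MM : (M + M = n * 2 ^ j.+1)%N by rewrite ME expnS; lia.
exists (M + M)%N, (fun z => hypot (g2 (lsubmx z)) (h2 (rsubmx z))); split.
- by rewrite MM muln_gt0 n0 expn_gt0.
- exact: dual_gauges_hypot.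
rewrite vol_dual_gauges_hypot//.
move: E2; set a := vol _; set b := vol _ => E2.
have F0 : 0 < (M + M)`!%:R :> R by rewrite ltr0n fact_gt0.
(* With [C = c^(2^(j+1))], the claim becomes [C 4^M M!^2 < (2M)!]. The central binomial bound
   reduces it to [C (2M + 1) < 1], which is the choice of [j]. *)
rewrite -(@lte_pmul2l _ (M + M)`!%:R%:E) ?lte_fin//.
rewrite [X in (X < _)%E](_ : _ =
    ((M`! ^ 2)%:R * (c ^+ (2 ^ j) ^+ 2 * 4 ^+ (M + M)))%:E); last first.
  by rewrite EFinM -E2 expnS expn1 natrM EFinM muleACA muleCA.
rewrite -EFinM lte_fin -exprM -expnSr.
move: jP; rewrite -MM => jP.
have := fact_double_ge M; rewrite -(ler_nat R) factS !natrM natrX => HF.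
rewrite (_ : 2 ^+ (M + M) = 4 ^+ M :> R); last first.
  by rewrite addnn -mul2n exprM; congr (_ ^+ _); ring.
rewrite exprD.
have q0 : 0 < 4 ^+ M :> R by rewrite exprn_gt0.
set C := c ^+ _ in jP *; have C0 : 0 <= C by rewrite exprn_ge0.
apply: (@le_lt_trans _ _ (C * 4 ^+ M * ((M + M).+1%:R * (M + M)`!%:R))).
  have := ler_wpM2l (mulr_ge0 C0 (ltW q0)) HF.
  apply: le_trans; rewrite le_eqVlt; apply/orP; left; apply/eqP; ring.
rewrite -[(M + M).+1%:R]natr1 [ltLHS](_ : _ = C * ((M + M)%:R + 1) * (4 ^+ M *
  (M + M)`!%:R)); last first.
  by ring.
rewrite [ltRHS](_ : _ = 1 * (4 ^+ M * (M + M)`!%:R)); last by ring.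
by rewrite ltr_pM2r// mulr_gt0.
Qed.

(** The hypothesis on reductions enters by contraposition: if the disc sum met its bound, so would
    its reduction [g]. Hence deficiency survives each disc sum, although the normalised volume grows
    by [pi] and the bound only by 2. *)
Lemma iter_disc_sum (R : realType) m (g : 'rV[R]_(m + m) -> R) k :
  (forall n : nat, (2 <= n)%N -> forall X : set 'rV[R]_(n + n),
      convex_body X -> symplectically_self_polar X ->
      ((2 ^+ n / n`!%:R)%:E <= vol X)%E ->
      forall Y : set 'rV[R]_(n.-1 + n.-1),
        linear_symplectic_reduction X Y ->
        ((2 ^+ n.-1 / (n.-1)`!%:R)%:E <= vol Y)%E) ->
  (0 < m)%N -> self_polar_gauge g ->
  (m`!%:R%:E * vol [set x | (g x <= 1)%R] < (2 ^+ m)%R%:E)%E ->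
  ((pi ^+ k)%R%:E * (m`!%:R%:E * vol [set x | (g x <= 1)%R]) <
    (2 ^+ (m + k))%R%:E)%E.
Proof.
move=> red; elim: k m g => [|k IH] m g m0 gs gsmall.
  by rewrite mul1e addn0.
have [gg _ _] := gs.
rewrite exprSr EFinM -muleA -vol_disc_sum// (_ : m + k.+1 = m.+1 + k)%N;
  last first.
  by rewrite addnS.
apply: IH => //; first exact: self_polar_disc_sum.
rewrite ltNge; apply/negP => big; move: gsmall; rewrite ltNge => /negP; apply.
have F (p : nat) (a : \bar R) : ((2 ^+ p)%R%:E <= p`!%:R%:E * a)%E <->
    ((2 ^+ p / p`!%:R)%:E <= a)%E.
  have p0 : 0 < p`!%:R :> R by rewrite ltr0n fact_gt0.
  by rewrite -lee_pdivrMl// -EFinM mulrC.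
have [bX sX] := self_polar_gauge_body (self_polar_disc_sum gs).
apply/F; apply: (red m.+1 m0 _ bX sX _ _ (disc_sum_reduction gg)).
exact/F.
Qed.

Lemma reduction_mahler (R : realType) :
  (forall n : nat, (2 <= n)%N -> forall X : set 'rV[R]_(n + n),
      convex_body X -> symplectically_self_polar X ->
      ((2 ^+ n / n`!%:R)%:E <= vol X)%E ->
      forall Y : set 'rV[R]_(n.-1 + n.-1),
        linear_symplectic_reduction X Y ->
        ((2 ^+ n.-1 / (n.-1)`!%:R)%:E <= vol Y)%E) ->
  forall n : nat, (1 <= n)%N -> forall K : set 'rV[R]_n,
      convex_body K -> centrally_symmetric K ->
      ((4 ^+ n / n`!%:R)%:E <= vol K * vol (polar K))%E.
Proof.
move=> red n n0 K bK sK; rewrite leNgt; apply/negP => small.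
have [g [h [gh KE PE]]] := symmetric_body_dual_gauges bK sK.
have F0 : 0 < n`!%:R :> R by rewrite ltr0n fact_gt0.
have V0 : (0 <= vol K * vol (polar K))%E.
  by rewrite !vol_iint mule_ge0//; apply: iint_ge0 => x; rewrite lee_fin.
move: small V0; rewrite PE.
case vE : (vol _ * vol _)%E => [v| |] //; rewrite lte_fin lee_fin => vlt v0.
have q0 : 0 < 4 ^+ n :> R by rewrite exprn_gt0.
pose c := v * n`!%:R / 4 ^+ n.
have c0 : 0 <= c by rewrite divr_ge0 ?mulr_ge0// ltW.
have c1 : c < 1 by rewrite ltr_pdivrMr// mul1r -ltr_pdivlMr.
have [|M [G [M0 Gs Gsmall]]] := @small_self_polar_gauge R n g h c n0 gh c0 c1.
  by rewrite -KE vE -EFinM; congr EFin; rewrite /c divfK ?gt_eqF// mulrC.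
have [gG _ _] := Gs.
have P := gauge_vol_gt0 gG.
set V := (M`!%:R%:E * vol [set x | (G x <= 1)%R])%E in Gsmall.
have Vpos : (0 < V)%E by rewrite mule_gt0// lte_fin ltr0n fact_gt0.
have H k := iter_disc_sum k red M0 Gs Gsmall.
move: H Gsmall Vpos; rewrite -/V; case: V => [w H _|//|//];
  rewrite lte_fin => w0.
(* The bounds now read [w (1 + e)^k < 2^M] for every [k]; Bernoulli refutes this as soon as [k]
   exceeds [2^M / (w e)]. *)
pose e : R := pi / 2 - 1.
have e0 : 0 < e by rewrite subr_gt0 ltr_pdivlMr// mul1r pi_gt2.
pose k := Num.bound (2 ^+ M / (w * e)).
have b0 : 0 <= 2 ^+ M / (w * e).
  by rewrite divr_ge0 ?exprn_ge0// mulr_ge0// ltW.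
have := archi_boundP b0; rewrite -/k ltr_pdivrMr ?mulr_gt0// => kP.
have := H k; rewrite -EFinM lte_fin.
have -> : pi = (1 + e) * 2 :> R by rewrite /e; field.
rewrite exprMn exprD mulrAC ltr_pM2r ?exprn_gt0// => lt1.
have := bernoulli_ineq k (ltW e0) => B.
have : w * (1 + k%:R * e) <= w * (1 + e) ^+ k by rewrite ler_wpM2l// ltW.
move=> lt2; have : w * (1 + k%:R * e) < 2 ^+ M.
  by apply: le_lt_trans lt2 _; rewrite mulrC.
have -> : w * (1 + k%:R * e) = w + k%:R * (w * e) by ring.
by move: kP w0; clear; lra.
Qed.

Theorem theorem4p3 (R : realType) :
  (forall n : nat, (2 <= n)%N ->
    forall X : set 'rV[R]_(n + n),
      convex_body X -> symplectically_self_polar X ->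
      ((2 ^+ n / n`!%:R)%:E <= vol X)%E ->
      forall Y : set 'rV[R]_(n.-1 + n.-1),
        linear_symplectic_reduction X Y ->
        ((2 ^+ n.-1 / (n.-1)`!%:R)%:E <= vol Y)%E)
  <->
  (forall n : nat, (1 <= n)%N ->
    forall K : set 'rV[R]_n,
      convex_body K -> centrally_symmetric K ->
      ((4 ^+ n / n`!%:R)%:E <= vol K * vol (polar K))%E).
Proof.
split; first exact: (@reduction_mahler R).
move=> mahler n n2 X bX sX _ Y.
by apply: reduction_vol_bound => //; case: n n2 {X bX sX Y} => [|[]].
Qed.
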